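(* Let $N_H\ge1$ and $k\ge0$ be integers, let $(C_{n,h})_{0\le n\le N_H-1}$ be a solution on $[0,\infty)$ of the semi-discrete discontinuous Galerkin/Hermite scheme for the Vlasov equation given in the context, with a given discrete electric field $E_{N_H,h}$, and let $f_{N_H,N_x}(t,x,v)=\sum_{n=0}^{N_H-1}C_{n,h}(t,x)\Psi_n(t,v)$. Then: (1) Mass is conserved: $\frac{d}{dt}\int_0^LC_{0,h}\,dx=0$. (2) Assuming that $\|f_{N_H,N_x}(0)\|_{\omega(0)}<+\infty$, for all $t\ge0$, $$\frac{d}{dt}\|f_{N_H,N_x}(t)\|_{\omega(t)}^2+\alpha(t)\sum_{n=1}^{N_H-1}\sum_{j}\delta_n\,[C_{n,h}]_{j-\frac12}^2\le\frac1{2\gamma}\|f_{N_H,N_x}(t)\|_{\omega(t)}^2,$$ and consequently $$\|f_{N_H,N_x}(t)\|_{\omega(t)}\le\|f_{N_H,N_x}(0)\|_{\omega(0)}\,e^{t/(4\gamma)},\qquad\forall t\ge0.$$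
   Context: Let $L>0$, $\alpha_0>0$, $\gamma>0$; all functions are real-valued. Let $0=x_{\frac12}<x_{\frac32}<\dots<x_{N_x+\frac12}=L$ be a partition of $[0,L]$ with cells $I_i=[x_{i-\frac12},x_{i+\frac12}]$, and $$V_h^k=\{u\in L^2(0,L):\ u|_{I_i}\in P_k(I_i)\ \forall i\},$$ where $P_k(I)$ is the set of polynomials of degree at most $k$ on $I$. Periodic boundary conditions are used (the points $0$ and $L$ are identified when taking one-sided limits). With $u^\pm_{i+\frac12}=\lim_{\Delta x\to0^\pm}u(x_{i+\frac12}+\Delta x)$, jumps and averages are $[u]_{i+\frac12}=u^+_{i+\frac12}-u^-_{i+\frac12}$ and $\{u\}_{i+\frac12}=\frac12(u^+_{i+\frac12}+u^-_{i+\frac12})$. Sums over $j$ run over $j=1,\dots,N_x$. Hermite polynomials: $H_{-1}=0$, $H_0=1$, $\sqrt n\,H_n(\xi)=\xi H_{n-1}(\xi)-\sqrt{n-1}\,H_{n-2}(\xi)$ for $n\ge1$. Basis functions: $\Psi_n(t,v)=\alpha(t)\,H_n(\alpha(t)v)\,\frac{e^{-(\alpha(t)v)^2/2}}{\sqrt{2\pi}}$. $E_{N_H,h}(t,x)$ is the chosen spatial approximation of the electric field: a bounded function of $x$ for each $t$, depending continuously on $t$ in the sup norm $\|\cdot\|_\infty$ (no particular approximation of the Poisson equation is imposed here). The scaling function is $$\alpha(t)=\alpha_0\left(1+\gamma\,\alpha_0^2\int_0^t\|E_{N_H,h}(s)\|_\infty^2\,ds\right)^{-1/2},$$ so $\alpha(0)=\alpha_0$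 and $\alpha'=-\frac\gamma2\|E_{N_H,h}(t)\|_\infty^2\alpha^3$. Weight and norm: $\omega(t,v)=\sqrt{2\pi}\,e^{(\alpha(t)v)^2/2}$ and $\|u\|_{\omega(t)}^2=\int_0^L\int_{\mathbb{R}}|u(x,v)|^2\omega(t,v)\,dv\,dx$; equivalently $\|f_{N_H,N_x}(t)\|_{\omega(t)}^2=\sum_{n=0}^{N_H-1}\alpha(t)\int_0^LC_{n,h}^2(t,x)\,dx$. DG scheme for the Vlasov equation: $C_{n,h}(t,\cdot)\in V_h^k$, continuously differentiable in $t$, with the convention $C_{n,h}=0$ for $n<0$ and for $n\ge N_H$, such that for all $\varphi_n\in V_h^k$, all $j$ and $0\le n\le N_H-1$, $$\frac{d}{dt}\int_{I_j}C_{n,h}\varphi_n\,dx-\frac{\alpha'}{\alpha}\int_{I_j}\left(nC_{n,h}+\sqrt{(n-1)n}\,C_{n-2,h}\right)\varphi_n\,dx+a_n^j(g_n,\varphi_n)-\alpha\sqrt n\int_{I_j}E_{N_H,h}C_{n-1,h}\varphi_n\,dx=0,$$ where $$a_n^j(g_n,\varphi_n)=-\int_{I_j}g_n\varphi_n'\,dx+\hat g_{n,j+\frac12}\varphi^-_{n,j+\frac12}-\hat g_{n,j-\frac12}\varphi^+_{n,j-\frac12},\qquad g_n=\frac1\alpha\left(\sqrt{n+1}\,C_{n+1,h}+\sqrt n\,C_{n-1,h}\right),$$ with numerical flux $\hat g_n=\frac12\left[g_n^-+g_n^+-\delta_n(C_{n,h}^+-C_{n,h}^-)\right]$, $\delta_0=0$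 and $\delta_n=\sqrt{N_H}/\alpha(t)$ for $1\le n\le N_H-1$. *)

(* Defs.v *)
From HB Require Import structures.
From mathcomp Require Import all_boot all_order all_algebra.
From mathcomp Require Import all_classical all_reals all_analysis.
Set Implicit Arguments.
Unset Strict Implicit.
Unset Printing Implicit Defensive.
Import Order.TTheory GRing.Theory Num.Theory.
Import numFieldNormedType.Exports.
Local Open Scope classical_set_scope.
Local Open Scope ring_scope.

Section TimeDerivative.
Context {R : realType}.
Implicit Types (f : R -> R) (t : R).

(* The library's [derivable f t 1] and [derive1 f t], except that the difference
   quotient is restricted to the time half-line [0, +oo[: the derivative is
   two-sided for t > 0 and right-sided at t = 0. *)
Definition time_quotient f t : set_system R :=
  h^-1 * (f (h + t) - f t) @[h --> within [set h | 0 <= h + t] 0^'].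

Definition time_derivable f t : Prop := cvg (time_quotient f t).

Definition time_derive f t : R := lim (time_quotient f t).

Definition time_C1 f : Prop :=
  (forall t : R, 0 <= t -> time_derivable f t) /\
  {within `[0, +oo[, continuous (time_derive f)}.

End TimeDerivative.

Section Mesh.
Context {R : realType}.

(* [x i] is the node written x_{i+1/2}; the cell with endpoints [x j] and
   [x j.+1], j < Nx, is the one written I_{j+1}. *)
Definition mesh (L : R) (Nx : nat) (x : nat -> R) : Prop :=
  [/\ x 0%N = 0, x Nx = L & forall i, (i < Nx)%N -> x i < x i.+1].

Definition cell (x : nat -> R) (j : nat) : set R := `[x j, x j.+1].

(* An element of V_h^k is an L^2 class, so nothing is required at the nodes:
   the restriction to a cell is polynomial on the interior of the cell. *)
Definition dg_space (Nx : nat) (x : nat -> R) (k : nat) (u : R -> R) : Prop :=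
  forall j, (j < Nx)%N -> exists2 p : {poly R}, (size p <= k.+1)%N &
    forall y, y \in `]x j, x j.+1[ -> u y = p.[y].

(* One-sided limits at the node x_{i+1/2}, 0 <= i <= Nx, the nodes 0 and Nx
   being identified by periodicity. *)
Definition trace_plus (Nx : nat) (x : nat -> R) (u : R -> R) (i : nat) : R :=
  lim (u y @[y --> (if i == Nx then x 0%N else x i)^'+]).

Definition trace_minus (Nx : nat) (x : nat -> R) (u : R -> R) (i : nat) : R :=
  lim (u y @[y --> (if i == 0%N then x Nx else x i)^'-]).

Definition jump (Nx : nat) (x : nat -> R) (u : R -> R) (i : nat) : R :=
  trace_plus Nx x u i - trace_minus Nx x u i.

End Mesh.

Section Field.
Context {R : realType}.
Local Notation mu := (@lebesgue_measure R).

Definition sup_norm (L : R) (u : R -> R) : R :=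
  sup [set `|u y| | y in `[0, L]].

(* Measurability in space is what gives a meaning to the integrals of
   E C_{n-1} phi in the scheme. *)
Definition admissible_field (L : R) (E : R -> R -> R) : Prop :=
  [/\ forall t : R, 0 <= t -> measurable_fun `[0, L] (E t),
      forall t : R, 0 <= t -> has_ubound [set `|E t y| | y in `[0, L]] &
      forall t : R, 0 <= t ->
        sup_norm L (E s \- E t) @[s --> within `[0, +oo[ (nbhs t)] --> (0 : R)].

Definition scaling (L alpha0 gamma : R) (E : R -> R -> R) (t : R) : R :=
  alpha0 * (1 + gamma * alpha0 ^+ 2 *
    (\int[mu]_(s in `[0, t]) (sup_norm L (E s) ^+ 2))) `^ (- 2^-1).

End Field.

Section Hermite.
Context {R : realType}.
Local Notation mu := (@lebesgue_measure R).

Fixpoint hermite (n : nat) : {poly R} :=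
  if n is m.+1 then
    (Num.sqrt m.+1%:R)^-1 *:
      ('X * hermite m - Num.sqrt m%:R *: (if m is l.+1 then hermite l else 0))
  else 1.

Implicit Types (alpha : R -> R) (t v : R).

Definition hermite_basis alpha (n : nat) t v : R :=
  alpha t * (hermite n).[alpha t * v] *
  (expR (- ((alpha t * v) ^+ 2 / 2)) / Num.sqrt (2 * pi)).

Definition hermite_sum (NH : nat) alpha (C : nat -> R -> R -> R) t (y v : R) : R :=
  \sum_(n < NH) C n t y * hermite_basis alpha n t v.

Definition weight alpha t v : R :=
  Num.sqrt (2 * pi) * expR ((alpha t * v) ^+ 2 / 2).

Definition wnorm_sq (L : R) alpha t (u : R -> R -> R) : \bar R :=
  (\int[mu]_(y in `[0%R, L]) \int[mu]_v (`|u y v| ^+ 2 * weight alpha t v)%:E)%E.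

Definition wnorm (L : R) alpha t (u : R -> R -> R) : \bar R :=
  sqrte (wnorm_sq L alpha t u).

End Hermite.

Section Scheme.
Context {R : realType}.
Local Notation mu := (@lebesgue_measure R).
Variables (NH Nx : nat) (x : nat -> R) (alpha : R -> R).
Implicit Types (E : R -> R -> R) (C : nat -> R -> R -> R).

(* In all formulas below the coefficients of C_{n-1} and C_{n-2} vanish as soon
   as the index is negative, so the truncated [n.-1] and [n.-2] are harmless. *)
Definition flux_fun C (n : nat) (t y : R) : R :=
  (alpha t)^-1 * (Num.sqrt n.+1%:R * C n.+1 t y + Num.sqrt n%:R * C n.-1 t y).

Definition delta (n : nat) (t : R) : R :=
  if n == 0%N then 0 else Num.sqrt NH%:R / alpha t.

Definition numerical_flux C (n : nat) (t : R) (i : nat) : R :=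
  2^-1 * (trace_minus Nx x (flux_fun C n t) i
          + trace_plus Nx x (flux_fun C n t) i
          - delta n t * jump Nx x (C n t) i).

Definition dg_form C (n : nat) (t : R) (j : nat) (phi : R -> R) : R :=
  - (\int[mu]_(y in cell x j) (flux_fun C n t y * derive1 phi y))
  + numerical_flux C n t j.+1 * trace_minus Nx x phi j.+1
  - numerical_flux C n t j * trace_plus Nx x phi j.

Record dg_solution (k : nat) E C : Prop := DGSolution {
  dg_ge_NH : forall n t y, (NH <= n)%N -> C n t y = 0;
  dg_in_space : forall n (t : R), (n < NH)%N -> 0 <= t -> dg_space Nx x k (C n t);
  (* V_h^k is finite-dimensional, so this is C^1 regularity of the
     V_h^k-valued map t |-> C_n(t, .). *)
  dg_C1 : forall n j y, (n < NH)%N -> (j < Nx)%N -> y \in `]x j, x j.+1[ ->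
    time_C1 (fun t => C n t y);
  dg_equation : forall n j phi (t : R), (n < NH)%N -> (j < Nx)%N ->
    dg_space Nx x k phi -> 0 <= t ->
    time_derive (fun s => \int[mu]_(y in cell x j) (C n s y * phi y)) t
    - time_derive alpha t / alpha t *
      (\int[mu]_(y in cell x j)
        ((n%:R * C n t y + Num.sqrt (n.-1 * n)%:R * C n.-2 t y) * phi y))
    + dg_form C n t j phi
    - alpha t * Num.sqrt n%:R *
      (\int[mu]_(y in cell x j) (E t y * C n.-1 t y * phi y)) = 0 }.

End Scheme.

(* Main.v *)
Require Import Defs.
From HB Require Import structures.
From mathcomp Require Import all_boot all_order all_algebra.
From mathcomp Require Import all_classical all_reals all_analysis.
From mathcomp Require Import measurable_realfun qpoly ring.
Set Implicit Arguments.
Unset Strict Implicit.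
Unset Printing Implicit Defensive.
Import Order.TTheory GRing.Theory Num.Theory.
Import numFieldNormedType.Exports.
Local Open Scope classical_set_scope.
Local Open Scope ring_scope.

(** Integration by parts against a Gaussian (Stein's identity) makes the Hermite
    polynomials orthonormal, so that [||f||^2 = alpha * sum_n int C_n^2].  Testing
    the scheme with [phi = C_n] and summing over [n] leaves three contributions.
    With [S_n = sqrt (n + 1) C_(n+1) + sqrt n C_(n-1)], the terms in [alpha'] add
    up to [alpha' sum_n S_n^2], and the electric field contributes
    [alpha^2 sum_n E C_n S_n], which is absorbed by completing the square because
    [alpha' = - gamma / 2 * ||E||^2 * alpha^3].  The volume part of the transport
    form is an exact derivative, so after summation over the cells only the
    interface terms [delta_n [C_n]^2 / 2] survive.  Gronwall's inequality gives
    the growth bound; mass conservation comes from the test function [phi = 1]. *)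

(** * Gaussian integrals of polynomials *)

Section GaussianWeight.
Context {R : realType}.
Local Notation mu := (@lebesgue_measure R).
Implicit Types (a : R) (p q : {poly R}).

(** The scheme provides regularity in time only point by point: [C n t y] is C^1 in [t] for each [y]
    inside a cell, whereas the energy is an integral over [y]. Differentiation under the integral is
    replaced by linear algebra: Lagrange interpolation at [k + 1] interior points of a cell writes
    its polynomial as a finite sum of terms [C n t (y i) *: l i], so its integrals become finite
    sums of differentiable functions. This also settles a second difficulty: the scheme takes a test
    function frozen in time, while the energy contains [C n t] twice. A single polynomial [D], the
    time derivative of the cell polynomial, enters both the tested equation and the derivative of
    the square, so [phi] may be [C n t] at the instant considered. Values at the mesh nodes are
    arbitrary, hence functions and polynomials are compared on open cells only. Finally,
    multiplication by the velocity raises the Hermite degree by one: [S_n] may be nonzero at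
    [n = NH], so the sums over [S_n] have [NH + 1] terms. *)

Definition gauss_density a (v : R) : R :=
  a * (expR (- ((a * v) ^+ 2 / 2)) / Num.sqrt (2 * pi)).

Lemma gauss_density_ge0 a v : 0 < a -> 0 <= gauss_density a v.
Proof.
by move=> a0; rewrite mulr_ge0 ?(ltW a0)// divr_ge0 ?expR_ge0 ?sqrtr_ge0.
Qed.

Lemma gauss_density_normal_pdf a : 0 < a ->
  gauss_density a = normal_pdf 0 a^-1.
Proof.
move=> a0; apply/funext => v; rewrite normal_pdfE ?invr_neq0 ?gt_eqF//.
rewrite /normal_peak /normal_fun subr0.
have -> : a^-1 ^+ 2 * pi *+ 2 = a^-1 ^+ 2 * (2 * pi) by ring.
rewrite sqrtrM ?sqr_ge0// sqrtr_sqr gtr0_norm ?invr_gt0// invfM invrK.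
have -> : - v ^+ 2 / (a^-1 ^+ 2 *+ 2) = - ((a * v) ^+ 2 / 2).
  by field; rewrite gt_eqF.
by rewrite /gauss_density; ring.
Qed.

Lemma integrable_gauss_density a : 0 < a ->
  mu.-integrable [set: R] (fun v => (gauss_density a v)%:E).
Proof.
by move=> a0; rewrite gauss_density_normal_pdf//; exact: integrable_normal_pdf.
Qed.

(** For [|x| >= 1], bound the power by its square, which is a term of the exponential series at
    [x ^+ 2 / 4] up to a constant; for [|x| <= 1], the constant [1] suffices. The rate [1 / 4] is
    half that of the Gaussian, so absorbing the growth leaves Gaussian decay. *)
Lemma normr_exp_le_expR (n : nat) : exists2 M : R, 0 <= M &
  forall x : R, `|x| ^+ n <= M * expR (x ^+ 2 / 4).
Proof.
case: n => [|n].
  exists 1 => // x; rewrite expr0 mul1r -[leLHS]expR0 ler_expR.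
  by rewrite divr_ge0 ?sqr_ge0.
exists (1 + 4 ^+ n.+1 * n.+1`!%:R) => [|x].
  by rewrite addr_ge0// mulr_ge0// exprn_ge0.
have y0 : 0 <= x ^+ 2 / 4 by rewrite divr_ge0 ?sqr_ge0.
have e1 : 1 <= expR (x ^+ 2 / 4) by rewrite -[leLHS]expR0 ler_expR.
have [x1|/ltW x1] := lerP `|x| 1.
  apply: (@le_trans _ _ 1); first exact: exprn_ile1.
  by rewrite mulrDl mul1r ler_wpDr// !mulr_ge0// ?exprn_ge0 ?expR_ge0.
have := expR_ge1Dxn n y0.
have f0 : 0 < n.+1`!%:R :> R by rewrite ltr0n fact_gt0.
have -> : (x ^+ 2 / 4) ^+ n.+1 = (`|x| ^+ n.+1) ^+ 2 / 4 ^+ n.+1.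
  by rewrite expr_div_n -real_normK ?num_real// exprAC.
move=> le1; rewrite mulrDl mul1r ler_wpDl ?expR_ge0//.
have le2 : (`|x| ^+ n.+1) ^+ 2 / 4 ^+ n.+1 / n.+1`!%:R <= expR (x ^+ 2 / 4).
  by apply: le_trans le1; rewrite ler_wpDl.
rewrite !ler_pdivrMr ?exprn_gt0// in le2.
apply: le_trans (_ : (`|x| ^+ n.+1) ^+ 2 <= _).
  by rewrite expr2 ler_peMl ?exprn_ge0// exprn_ege1.
by apply: le_trans le2 _; rewrite -mulrA mulrC [_%:R * _]mulrC.
Qed.

Lemma normr_horner_le_expR p : exists2 M : R, 0 <= M &
  forall x, `|p.[x]| <= M * expR (x ^+ 2 / 4).
Proof.
have [M M_ge0 Mle] : exists2 M : nat -> R, (forall n, 0 <= M n) &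
    forall n (x : R), `|x| ^+ n <= M n * expR (x ^+ 2 / 4).
  have /choice[M HM] : forall n, exists M : R, 0 <= M /\
      forall x : R, `|x| ^+ n <= M * expR (x ^+ 2 / 4).
    by move=> n; have [M ? ?] := normr_exp_le_expR n; exists M.
  by exists M => n; have [] := HM n.
exists (\sum_(i < size p) `|p`_i| * M i) => [|x].
  by apply: sumr_ge0 => i _; rewrite mulr_ge0.
rewrite horner_coef mulr_suml (le_trans (ler_norm_sum _ _ _))//.
by apply: ler_sum => i _; rewrite normrM normrX -mulrA ler_wpM2l.
Qed.

Lemma continuous_horner_scale p a : continuous (fun v : R => p.[a * v]).
Proof.
move=> v; apply: (continuous_comp (f := fun v => a * v) (g := horner p)).
  exact: mulrl_continuous.
exact: continuous_horner.
Qed.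

Lemma continuous_gauss_density a : 0 < a -> continuous (gauss_density a).
Proof.
move=> a0; rewrite gauss_density_normal_pdf//.
by apply: continuous_normal_pdf; rewrite invr_neq0 ?gt_eqF.
Qed.

Lemma continuous_horner_gauss p a : 0 < a ->
  continuous (fun v : R => p.[a * v] * gauss_density a v).
Proof.
move=> a0 v; apply: cvgM; first exact: continuous_horner_scale.
exact: continuous_gauss_density.
Qed.

(** Half of the Gaussian exponent absorbs the polynomial. What remains is stated both as a
    [gauss_fun], whose limit at infinity is known, and as a wider normal density, which is
    integrable. *)
Lemma horner_gauss_le p a : 0 < a -> exists M, forall v,
  `|p.[a * v] * gauss_density a v| <= M * gauss_fun (a / 2 * v) /\
  `|p.[a * v] * gauss_density a v| <= M * gauss_density (a / Num.sqrt 2) v.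
Proof.
move=> a0; have [M M0 pM] := normr_horner_le_expR p.
have s2 : 0 < Num.sqrt (2 : R) by rewrite sqrtr_gt0.
have s2p : 0 < Num.sqrt (2 * pi : R) by rewrite sqrtr_gt0 mulr_gt0// pi_gt0.
have h v : `|p.[a * v] * gauss_density a v| <=
    M * a / Num.sqrt (2 * pi) * expR (- ((a * v) ^+ 2 / 4)).
  rewrite normrM [`|gauss_density _ _|]ger0_norm ?gauss_density_ge0//.
  apply: (le_trans (ler_wpM2r (gauss_density_ge0 v a0) (pM _))).
  rewrite /gauss_density.
  have -> : - ((a * v) ^+ 2 / 2) = - ((a * v) ^+ 2 / 4) - ((a * v) ^+ 2 / 4).
    by field.
  rewrite expRD expRN; set e := expR _.
  have e0 : 0 < e := expR_gt0 _.
  by rewrite le_eqVlt; apply/orP; left; apply/eqP; field; rewrite ?gt_eqF.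
have c0 : 0 <= M * a / Num.sqrt (2 * pi).
  by rewrite divr_ge0 ?mulr_ge0// ltW.
have m0 : 0 <= M * Num.sqrt 2 by rewrite mulr_ge0// ltW.
(* The two summands are the constants of the two majorants; their sum serves both. *)
exists (M * a / Num.sqrt (2 * pi) + M * Num.sqrt 2) => v; split.
  apply: (le_trans (h v)); rewrite [leRHS]mulrDl ler_wpDr ?mulr_ge0 ?gauss_fun_ge0//.
  rewrite /gauss_fun; have -> : - ((a * v) ^+ 2 / 4) = - (a / 2 * v) ^+ 2.
    by field.
  by [].
apply: (le_trans (h v)); rewrite [leRHS]mulrDl ler_wpDl//.
  by rewrite mulr_ge0// gauss_density_ge0// divr_gt0.
rewrite /gauss_density.
have -> : (a / Num.sqrt 2 * v) ^+ 2 / 2 = (a * v) ^+ 2 / 4.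
  by rewrite !exprMn exprVn sqr_sqrtr//; field.
by rewrite le_eqVlt; apply/orP; left; apply/eqP; field; rewrite ?gt_eqF.
Qed.

Lemma integrable_horner_gauss p a : 0 < a ->
  mu.-integrable [set: R] (fun v => (p.[a * v] * gauss_density a v)%:E).
Proof.
move=> a0; have [M hM] := horner_gauss_le p a0.
have s2 : 0 < Num.sqrt (2 : R) by rewrite sqrtr_gt0.
apply: (@le_integrable _ _ _ mu _ measurableT _
  (fun v => (M%:E * (gauss_density (a / Num.sqrt 2) v)%:E)%E)).
- apply/measurable_EFinP; apply: continuous_measurable_fun.
  exact: continuous_horner_gauss.
- move=> v _ /=; rewrite lee_fin; apply: le_trans (hM v).2 _; exact: ler_norm.
- by apply: integrableZl => //; apply: integrable_gauss_density; rewrite divr_gt0.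
Qed.

(** The sign [s] covers the two endpoints of [[- n, n]] at once. *)
Lemma horner_gauss_cvg0 p a (s : R) : 0 < a -> s ^+ 2 = 1 ->
  (p.[a * (s * n%:R)] * gauss_density a (s * n%:R)) @[n --> \oo] --> (0 : R).
Proof.
move=> a0 s1; have [M hM] := horner_gauss_le p a0.
apply/norm_cvg0P.
apply: (@squeeze_cvgr _ _ _ _ (fun _ => 0) (fun n => M * gauss_fun (a / 2 * n%:R))).
- near=> n; rewrite normr_ge0/=; apply: le_trans (hM _).1 _.
  by rewrite /gauss_fun mulrCA exprMn s1 mul1r.
- exact: cvg_cst.
- rewrite -[X in _ --> X](mulr0 M); apply: cvgMl_tmp.
  apply: (cvg_comp (fun n : nat => a / 2 * n%:R) _ _ cvg_gauss_fun).
  under eq_fun do rewrite mulrC.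
  apply: (cvg_comp _ (fun x => x * (a / 2)) cvgr_idn).
  by apply: gt0_cvgMly; rewrite ?divr_gt0.
Unshelve. all: by end_near. Qed.

End GaussianWeight.

(** * Stein's identity *)

Section Stein.
Context {R : realType}.
Local Notation mu := (@lebesgue_measure R).
Implicit Types (a : R) (p q : {poly R}).

Lemma is_derive_horner_gauss p a v : 0 < a ->
  is_derive v (1 : R) (fun v => p.[a * v] * gauss_density a v)
    (a * ((p^`() - 'X * p).[a * v] * gauss_density a v)).
Proof.
move=> a0.
have dh q : is_derive v (1 : R) (fun v : R => q.[a * v]) (q^`().[a * v] * a).
  apply: (is_derive1_comp (f := horner q) (g := fun v => a * v)).
  by apply: is_derive_eq; rewrite scaler1.
(* Writing the exponent as a polynomial in [a * v] lets [dh] differentiate both factors. *)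
pose q : {poly R} := - 2^-1 *: 'X^2.
have qE u : q.[u] = - (u ^+ 2 / 2) by rewrite /q hornerZ hornerXn; field.
have q'E u : q^`().[u] = - u.
  by rewrite /q derivZ derivXn hornerZ hornerMn hornerX mulr2n; field.
have -> : gauss_density a = fun u => a / Num.sqrt (2 * pi) * expR q.[a * u].
  by apply/funext => u; rewrite qE /gauss_density; ring.
have de : is_derive v (1 : R) (fun u => expR q.[a * u])
    (expR q.[a * v] * (q^`().[a * v] * a)).
  exact: (is_derive1_comp (f := expR) (g := fun u => q.[a * u])).
have d2 := is_deriveM (dh p)
  (is_deriveM (is_derive_cst (a / Num.sqrt (2 * pi)) v 1) de).
apply: (is_derive_eq d2).
rewrite /= /GRing.scale /= !fctE hornerD hornerN hornerM hornerX q'E; ring.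
Qed.

Lemma FTC_horner_gauss p a (n : nat) : 0 < a -> (0 < n)%N ->
  (\int[mu]_(v in `[(- n%:R)%R, n%:R%R])
     (a * ((p^`() - 'X * p).[a * v] * gauss_density a v))%:E)%E
   = ((p.[a * n%:R] * gauss_density a n%:R
      - p.[a * - n%:R] * gauss_density a (- n%:R))%:E).
Proof.
move=> a0 n0; have nn : - n%:R < n%:R :> R.
  by rewrite (@lt_trans _ _ 0)// ?oppr_lt0 ltr0n.
pose F v := p.[a * v] * gauss_density a v.
have dF v := is_derive_horner_gauss p v a0.
rewrite (@continuous_FTC2 _ _ F)//.
- apply: continuous_subspaceT => v; apply: cvgM; first exact: cvg_cst.
  exact: continuous_horner_gauss.
- split=> [v _| |]; first by have [] := dF v.
  + by apply: cvg_at_right_filter; exact: continuous_horner_gauss.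
  + by apply: cvg_at_left_filter; exact: continuous_horner_gauss.
- by move=> v _; rewrite derive1E; have [_ ->] := dF v.
Qed.

(** Up to the factor [a], the integrand is the derivative of [p.[a * v] * gauss_density a v]. Its
    integral over [[- n, n]] is a boundary term tending to [0], and dominated convergence identifies
    the limit with the integral over the line. *)
Lemma stein_identity p a : 0 < a ->
  \int[mu]_v ((p^`() - 'X * p).[a * v] * gauss_density a v) = 0.
Proof.
move=> a0; pose g (v : R) := (p^`() - 'X * p).[a * v] * gauss_density a v.
rewrite -[LHS]/(\int[mu]_v g v).
have ig : mu.-integrable [set: R] (EFin \o g) by exact: integrable_horner_gauss.
have iag : mu.-integrable [set: R] (fun v => (a * g v)%:E).
  have := integrableZl measurableT a ig.
  by apply: eq_integrable => // v _; rewrite /= EFinM.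
have mag : measurable_fun setT (fun v => (a * g v)%:E) by exact: measurable_int iag.
suff h : (\int[mu]_v (a * g v)%:E = 0)%E.
  have := RintegralZl a measurableT ig; rewrite /Rintegral h /= => /esym/eqP.
  by rewrite mulf_eq0 gt_eqF//= => /eqP.
pose In (n : nat) : set R := `[- n%:R, n%:R]%classic.
have mI n : measurable (In n) by exact: measurable_itv.
pose h_ n : R -> \bar R := (fun v => (a * g v)%:E) \_ (In n).
have c1 : (\int[mu]_v (h_ n v))%E @[n --> \oo] --> 0%E.
  have -> : (fun n => \int[mu]_v h_ n v)%E =
      (fun n => (p.[a * n%:R] * gauss_density a n%:R
      - p.[a * - n%:R] * gauss_density a (- n%:R))%:E).
    apply/funext => n; rewrite /h_ -integral_mkcond /In.
    case: n => [|n]; last by rewrite FTC_horner_gauss.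
    by rewrite oppr0 set_itv1 integral_set1 mulr0 subrr.
  apply: cvg_EFin; first exact: nearW.
  rewrite /comp/= -[X in _ --> X](subr0 0).
  apply: cvgB.
    have := @horner_gauss_cvg0 _ p a 1 a0 (expr1n _ _).
    by under eq_fun do rewrite mul1r.
  have := @horner_gauss_cvg0 _ p a (-1) a0 _; rewrite sqrrN expr1n => /(_ erefl).
  by under eq_fun do rewrite mulN1r.
have mh n : measurable_fun setT (h_ n).
  apply/(measurable_restrictT _ (mI n)); exact: measurable_funS mag.
have ch : {ae mu, forall v, [set: R] v -> h_ n v @[n --> \oo] --> (a * g v)%:E}.
  apply: aeW => v _; apply: cvg_near_cst; near=> n.
  rewrite /h_ patchE mem_set// /In/= in_itv/=.
  by rewrite -ler_norml; near: n; exact: nbhs_infty_ger.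
have bh : {ae mu, forall v n, [set: R] v -> (`|h_ n v| <= `|(a * g v)%:E|)%E}.
  by apply: aeW => v n _; rewrite /h_ patchE; case: ifP => // _; rewrite abse0 abse_ge0.
have [_ _ c2] :=
  @dominated_convergence _ _ _ mu _ measurableT h_ _ _ mh mag ch
    (integrable_abse iag) bh.
exact: (cvg_unique _ c2 c1).
Unshelve. all: by end_near. Qed.

End Stein.

(** * Orthonormality of the Hermite polynomials *)

Section HermiteOrthonormality.
Context {R : realType}.
Local Notation mu := (@lebesgue_measure R).
Local Notation H := (@hermite R).
Implicit Types (a : R) (p q : {poly R}).

(** For [a > 0], the expectation of [p] under the standard normal law, in the scaled variable of the
    Hermite basis. *)
Definition gauss_mean a p : R := \int[mu]_v (p.[a * v] * gauss_density a v).

Lemma gauss_meanD a p q : 0 < a ->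
  gauss_mean a (p + q) = gauss_mean a p + gauss_mean a q.
Proof.
move=> a0; rewrite -RintegralD//; [|exact: integrable_horner_gauss..].
by apply: eq_Rintegral => v _; rewrite hornerD mulrDl.
Qed.

Lemma gauss_meanZ a c p : 0 < a -> gauss_mean a (c *: p) = c * gauss_mean a p.
Proof.
move=> a0; rewrite -RintegralZl//; last exact: integrable_horner_gauss.
by apply: eq_Rintegral => v _; rewrite hornerZ -mulrA.
Qed.

Lemma gauss_mean0 a : gauss_mean a 0 = 0.
Proof.
rewrite /gauss_mean; under eq_Rintegral do rewrite horner0 mul0r.
by rewrite Rintegral_cst// mul0r.
Qed.

Lemma gauss_mean1 a : 0 < a -> gauss_mean a 1 = 1.
Proof.
move=> a0; rewrite /gauss_mean; under eq_Rintegral do rewrite hornerC mul1r.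
by rewrite gauss_density_normal_pdf// /Rintegral integral_normal_pdf.
Qed.

Lemma gauss_mean_sum a (I : Type) (r : seq I) (P : pred I) (F : I -> {poly R}) :
  0 < a -> gauss_mean a (\sum_(i <- r | P i) F i)
           = \sum_(i <- r | P i) gauss_mean a (F i).
Proof.
move=> a0; apply: (big_morph (gauss_mean a)) => [p q|]; first exact: gauss_meanD.
exact: gauss_mean0.
Qed.

Lemma gauss_mean_deriv a p : 0 < a ->
  gauss_mean a p^`() = gauss_mean a ('X * p).
Proof.
move=> a0; have := stein_identity p a0; rewrite -/(gauss_mean a _).
by rewrite -scaleN1r gauss_meanD// gauss_meanZ// mulN1r => /subr0_eq.
Qed.

Lemma hermiteS n : Num.sqrt n.+1%:R *: H n.+1
  = 'X * H n - Num.sqrt n%:R *: H n.-1.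
Proof.
rewrite scalerA divff ?scale1r ?gt_eqF ?sqrtr_gt0 ?ltr0n//.
by case: n => [|n]//=; rewrite sqrtr0 !scale0r.
Qed.

Lemma sqrt_natr_neq0 n : Num.sqrt n.+1%:R != 0 :> R.
Proof. by rewrite gt_eqF// sqrtr_gt0 ltr0n. Qed.

(** Differentiating the recurrence gives [H n] plus [sqrt n] times the recurrence one step lower,
    that is [H n + n H n]. Two earlier indices occur, hence the strong induction. *)
Lemma hermite_deriv n : (H n)^`() = Num.sqrt n%:R *: H n.-1.
Proof.
elim/ltn_ind: n => -[|n] IH; first by rewrite derivC sqrtr0 scale0r.
apply: (scalerI (sqrt_natr_neq0 n)).
rewrite -derivZ hermiteS derivB derivM derivX mul1r derivZ IH//= IH; last first.
  by case: n {IH}.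
rewrite !scalerA -expr2 sqr_sqrtr ?ler0n// -natr1 scalerDl scale1r.
rewrite -addrA [LHS]addrC; congr (_ + _).
case: n {IH} => [|n]; first by rewrite sqrtr0 !(scale0r, mul0r, mulr0, scaler0) subr0.
by rewrite -scalerAr -scalerA -scalerBr -hermiteS scalerA -expr2 sqr_sqrtr ?ler0n.
Qed.

Lemma gauss_mean_hermiteS a n q : 0 < a ->
  Num.sqrt n.+1%:R * gauss_mean a (H n.+1 * q) = gauss_mean a (H n * q^`()).
Proof.
move=> a0; rewrite -gauss_meanZ// scalerAl hermiteS mulrBl -mulrA.
rewrite -scaleN1r gauss_meanD// gauss_meanZ// -gauss_mean_deriv// derivM.
by rewrite gauss_meanD// hermite_deriv mulN1r addrC addKr.
Qed.

(** Moving the raising operator across lowers both indices by one, until one factor is the constant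
    [H 0], whose derivative vanishes. *)
Lemma gauss_mean_hermite_orthonormal a n m : 0 < a ->
  gauss_mean a (H n * H m) = (n == m)%:R.
Proof.
move=> a0; have H0 k : gauss_mean a (H k.+1 * H 0) = 0.
  apply: (mulfI (sqrt_natr_neq0 k)).
  by rewrite gauss_mean_hermiteS// derivC mulr0 gauss_mean0 mulr0.
elim: n m => [|n IH] [|m].
- by rewrite mulr1 gauss_mean1.
- by rewrite mulrC H0.
- by rewrite H0.
- apply: (mulfI (sqrt_natr_neq0 n)); rewrite gauss_mean_hermiteS//.
  rewrite hermite_deriv -scalerAr gauss_meanZ// IH eqSS.
  by have [->|] := eqVneq n m; rewrite ?mulr0.
Qed.

(** The sum is [p.[a * v] * gauss_density a v], and the weight times one density is [a]. So the
    integrand is [a * p ^+ 2] against a single density, which is where the factor [alpha t] comes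
    from. *)
Lemma hermite_parseval NH (c : nat -> R) (alpha : R -> R) t : 0 < alpha t ->
  (\int[mu]_v (`|\sum_(n < NH) c n * hermite_basis alpha n t v| ^+ 2
     * weight alpha t v)%:E = (alpha t * \sum_(n < NH) c n ^+ 2)%:E)%E.
Proof.
move=> a0; set a := alpha t in a0 *.
pose p := \sum_(n < NH) c n *: H n.
have s2p : 0 < Num.sqrt (2 * pi : R) by rewrite sqrtr_gt0 mulr_gt0// pi_gt0.
transitivity (\int[mu]_v (((a *: (p * p)).[a * v]) * gauss_density a v)%:E)%E.
  apply: eq_integral => v _; congr EFin.
  have -> : \sum_(n < NH) c n * hermite_basis alpha n t v
      = p.[a * v] * gauss_density a v.
    rewrite /p horner_sum mulr_suml; apply: eq_bigr => n _.
    by rewrite hornerZ /hermite_basis /gauss_density -/a; ring.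
  rewrite real_normK ?num_real// hornerZ hornerM /gauss_density /weight -/a expRN.
  set e := expR _; have e0 : 0 < e := expR_gt0 _.
  by field; rewrite !gt_eqF.
have := @integrable_fin_num _ _ _ mu _ measurableT _
  (integrable_horner_gauss (a *: (p * p)) a0).
move=> /fineK <-; rewrite -/(Rintegral _ _ _) -/(gauss_mean _ _); congr EFin.
rewrite gauss_meanZ// {1}/p mulr_suml gauss_mean_sum//; congr (_ * _).
apply: eq_bigr => n _; rewrite -scalerAl gauss_meanZ// mulr_sumr gauss_mean_sum//.
rewrite (bigD1 n)//= -scalerAr gauss_meanZ// gauss_mean_hermite_orthonormal// eqxx.
rewrite big1 ?addr0 ?mulr1// => m; rewrite -val_eqE eq_sym => /negbTE mn.
by rewrite -scalerAr gauss_meanZ// gauss_mean_hermite_orthonormal// mn mulr0.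
Qed.

End HermiteOrthonormality.

(** * Derivatives on the time half-line *)

Section TimeDerivatives.
Context {R : realType}.
Implicit Types (f g : R -> R) (t l : R).

(** Existence and value in one relation: [time_derive] is a [lim], which is meaningful only once
    convergence is known. *)
Definition is_tderive f t l : Prop := time_quotient f t --> l.

Local Notation tnear t := (within [set h | 0 <= h + t] (0 : R)^').

Lemma tnear_proper t : 0 <= t -> ProperFilter (tnear t).
Proof.
move=> t0; apply: Build_ProperFilter => -[].
move=> e /= e0 /(_ (e / 2)); apply.
- by rewrite /= sub0r normrN gtr0_norm ?divr_gt0// ltr_pdivrMr// ltr_pMr// ltr1n.
- by rewrite gt_eqF// divr_gt0.
- by rewrite /= addr_ge0// divr_ge0// ltW.
Qed.

Lemma is_tderive_lim f t l : 0 <= t -> is_tderive f t l -> time_derive f t = l.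
Proof. by move=> t0 fl; have pt := tnear_proper t0; apply: cvg_lim. Qed.

Lemma is_tderive_derivable f t l : is_tderive f t l -> time_derivable f t.
Proof. by move=> fl; apply/cvg_ex; exists l. Qed.

Lemma time_derivableP f t : time_derivable f t -> is_tderive f t (time_derive f t).
Proof. by []. Qed.

Lemma eq_is_tderive f g t l : 0 <= t -> (forall s, 0 <= s -> f s = g s) ->
  is_tderive f t l -> is_tderive g t l.
Proof.
move=> t0 fg; apply: cvg_trans; apply: near_eq_cvg.
have : \forall h \near tnear t, 0 <= h + t by exact: withinT.
by apply: filterS => h ht; rewrite !fg.
Qed.

Lemma is_tderive_cst (c : R) t : is_tderive (fun=> c) t 0.
Proof.
rewrite /is_tderive /time_quotient; under eq_fun do rewrite subrr mulr0.
exact: cvg_cst.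
Qed.

Lemma is_tderiveD f g t l m : is_tderive f t l -> is_tderive g t m ->
  is_tderive (fun s => f s + g s) t (l + m).
Proof.
move=> fl gm; rewrite /is_tderive /time_quotient.
under eq_fun do rewrite opprD addrACA mulrDr.
exact: cvgD.
Qed.

Lemma is_tderive_sum (I : Type) (r : seq I) (P : pred I) (F : I -> R -> R)
    (l : I -> R) t :
  (forall i, P i -> is_tderive (F i) t (l i)) ->
  is_tderive (fun s => \sum_(i <- r | P i) F i s) t (\sum_(i <- r | P i) l i).
Proof.
move=> Fl; elim: r => [|i r IH].
  under eq_fun do rewrite big_nil; rewrite big_nil; exact: is_tderive_cst.
under eq_fun do rewrite big_cons; rewrite big_cons; case: ifPn => // Pi.
by apply: is_tderiveD => //; exact: Fl.
Qed.

Lemma is_tderive_cvg f t l : is_tderive f t l ->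
  f (h + t) @[h --> tnear t] --> f t.
Proof.
move=> fl; apply/subr_cvg0.
have : h * (h^-1 * (f (h + t) - f t)) @[h --> tnear t] --> 0 * l.
  apply: cvgM fl; apply: cvg_trans (@nbhs_dnbhs _ _); exact: cvg_within.
rewrite mul0r; apply: cvg_trans; apply: near_eq_cvg.
have : \forall h \near tnear t, h != 0.
  by apply: cvg_within; exact: (nbhs_dnbhs_neq (0 : R)).
by apply: filterS => h h0; rewrite mulrA mulfV// mul1r.
Qed.

Lemma is_tderiveM f g t l m : is_tderive f t l -> is_tderive g t m ->
  is_tderive (fun s => f s * g s) t (l * g t + f t * m).
Proof.
move=> fl gm; rewrite /is_tderive /time_quotient.
have -> : (fun h => h^-1 * (f (h + t) * g (h + t) - f t * g t)) =
    (fun h => h^-1 * (f (h + t) - f t) * g (h + t) + f t * (h^-1 * (g (h + t) - g t))).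
  by apply/funext => h; ring.
apply: cvgD; first by apply: cvgM fl _; exact: is_tderive_cvg gm.
by apply: cvgM gm; exact: cvg_cst.
Qed.

Lemma is_tderiveZ (c : R) f t l : is_tderive f t l ->
  is_tderive (fun s => c * f s) t (c * l).
Proof.
by move=> fl; have := is_tderiveM (is_tderive_cst c t) fl; rewrite mul0r add0r.
Qed.

Lemma is_derive_is_tderive f t l : is_derive t (1 : R) f l -> is_tderive f t l.
Proof.
case=> df <-; apply: cvg_trans df; rewrite /time_quotient.
have -> : (fun h : R => h^-1 *: ((f \o shift t) (h *: 1) - f t)) =
    (fun h => h^-1 * (f (h + t) - f t)).
  by apply/funext => h /=; rewrite [h%:A]mulr1.
by apply: cvg_app; exact: cvg_within.
Qed.

Lemma is_tderive_is_derive f t l : 0 < t -> is_tderive f t l ->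
  is_derive t (1 : R) f l.
Proof.
move=> t0 fl.
have cl : h^-1 *: ((f \o shift t) (h *: 1) - f t) @[h --> (0 : R)^'] --> l.
  under eq_fun do rewrite /= [_%:A]mulr1.
  apply: cvg_trans fl; rewrite /time_quotient; apply: cvg_app => A hA.
  have : \forall h \near (0 : R)^', 0 <= h + t.
    apply: nbhs_dnbhs; near=> h; rewrite -lerBlDr sub0r ltW//; near: h.
    by apply: lt_nbhsr; rewrite oppr_lt0.
  have : \forall h \near (0 : R)^', 0 <= h + t -> A h by exact: hA.
  by apply: filterS2 => h; apply.
apply: DeriveDef; first by apply/cvg_ex; exists l.
exact: cvg_lim cl.
Unshelve. all: by end_near. Qed.

Lemma is_tderive_continuous f (f' : R -> R) (b : R) : 0 < b ->
  (forall t, 0 <= t -> is_tderive f t (f' t)) -> {within `[0, b], continuous f}.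
Proof.
move=> b0 ff'; apply/(continuous_within_itvP _ b0).
have cf t : 0 < t -> {for t, continuous f}.
  move=> t0; have [df _] := is_tderive_is_derive t0 (ff' t (ltW t0)).
  by apply: differentiable_continuous; apply/derivable1_diffP.
split.
- by move=> t; rewrite in_itv/= => /andP[t0 _]; exact: cf.
- have := is_tderive_cvg (ff' 0 (lexx 0)).
  under eq_fun do rewrite addr0.
  apply: cvg_trans; apply: cvg_app => A hA.
  have hA0 : \forall h \near (0 : R), h != 0 -> 0 <= h + 0 -> A h by exact: hA.
  have : \forall h \near (0 : R)^'+, 0 < h by exact: nbhs_right_gt.
  have : \forall h \near (0 : R)^'+, h != 0 -> 0 <= h + 0 -> A h.
    by apply: cvg_within; exact: hA0.
  apply: filterS2 => h hh h0; apply: hh; first by rewrite gt_eqF.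
  by rewrite addr0 ltW.
- by apply: cvg_at_left_filter; exact: cf.
Qed.

(** The product of [f] and [expR (- c * s)] has a nonpositive derivative on the open interval. At
    [0] the derivative is one-sided, so that endpoint is reached by continuity. *)
Lemma tgronwall f (f' : R -> R) (c : R) :
  (forall t, 0 <= t -> is_tderive f t (f' t)) ->
  (forall t, 0 <= t -> f' t <= c * f t) ->
  forall t, 0 <= t -> f t <= f 0 * expR (c * t).
Proof.
move=> ff' fle t; rewrite le_eqVlt => /predU1P[<-|t0].
  by rewrite mulr0 expR0 mulr1.
pose e (s : R) := expR (- c * s).
have de (s : R) : is_derive s (1 : R) e (expR (- c * s) * - c).
  apply: (is_derive1_comp (f := expR) (g := fun s => - c * s)).
  by apply: is_derive_eq; rewrite scaler1.
pose g s := f s * e s.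
pose g' s := f' s * e s + f s * (expR (- c * s) * - c).
have dg (s : R) : 0 <= s -> is_tderive g s (g' s).
  by move=> s0; apply: is_tderiveM (ff' s s0) (is_derive_is_tderive (de s)).
have dg' (s : R) : 0 < s -> is_derive s (1 : R) g (g' s).
  by move=> s0; apply: is_tderive_is_derive s0 (dg s (ltW s0)).
have : g t <= g 0.
  apply: (@ler0_derive1_le_cc _ g 0 t) => //; rewrite ?in_itv/= ?lexx ?ltW//.
  - by move=> s; rewrite in_itv/= => /andP[s0 _]; have [] := dg' s s0.
  - move=> s; rewrite in_itv/= => /andP[s0 _]; rewrite derive1E.
    have [_ ->] := dg' s s0.
    have -> : g' s = expR (- c * s) * (f' s - c * f s) by rewrite /g' /e; ring.
    rewrite pmulr_rle0 ?expR_gt0// subr_le0.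
    by apply: fle; exact: ltW.
  - exact: (is_tderive_continuous t0 dg).
rewrite /g /e mulr0 expR0 mulr1 mulNr expRN ler_pdivrMr ?expR_gt0//.
Qed.

End TimeDerivatives.

(** * The scaling function *)

Section Scaling.
Context {R : realType}.
Local Notation mu := (@lebesgue_measure R).
Variables (L alpha0 gamma : R) (E : R -> R -> R).
Hypotheses (L_gt0 : 0 < L) (alpha0_gt0 : 0 < alpha0) (gamma_gt0 : 0 < gamma).
Hypothesis field_E : admissible_field L E.

Lemma sup_norm_ub (u : R -> R) y : has_ubound [set `|u y| | y in `[0, L]] ->
  0 <= y <= L -> `|u y| <= sup_norm L u.
Proof.
by move=> ub yL; apply: ub_le_sup => //; exists y => //=; rewrite in_itv.
Qed.

Lemma sup_norm_le (u : R -> R) (M : R) : (forall y, 0 <= y <= L -> `|u y| <= M) ->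
  sup_norm L u <= M.
Proof.
move=> uM; apply: ge_sup.
  by exists `|u 0|, 0 => //=; rewrite in_itv/= lexx ltW.
by move=> _ [y /= yL <-]; apply: uM; rewrite in_itv in yL.
Qed.

(** Reverse triangle inequality: it turns continuity of [E] in the sup norm into continuity of the
    real function [sup_norm L (E t)]. *)
Lemma sup_norm_dist (u v : R -> R) : has_ubound [set `|u y| | y in `[0, L]] ->
  has_ubound [set `|v y| | y in `[0, L]] ->
  `|sup_norm L u - sup_norm L v| <= sup_norm L (u \- v).
Proof.
move=> ubu ubv.
have ubuv : has_ubound [set `|(u \- v) y| | y in `[0, L]].
  exists (sup_norm L u + sup_norm L v) => _ [y /= yL <-]; rewrite in_itv/= in yL.
  by rewrite (le_trans (ler_normB _ _))// lerD// sup_norm_ub.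
rewrite ler_norml; apply/andP; split.
  rewrite lerNl opprB lerBlDr; apply: sup_norm_le => y yL.
  have -> : v y = u y - (u y - v y) by ring.
  rewrite (le_trans (ler_normB _ _))// addrC lerD// ?sup_norm_ub//.
  exact: (sup_norm_ub ubuv).
rewrite lerBlDr; apply: sup_norm_le => y yL.
have -> : u y = u y - v y + v y by ring.
rewrite (le_trans (ler_normD _ _))// lerD// ?sup_norm_ub//.
exact: (sup_norm_ub ubuv).
Qed.

Lemma field_ub t : 0 <= t -> has_ubound [set `|E t y| | y in `[0, L]].
Proof. by case: field_E => _ + _; apply. Qed.

(** The field is frozen at its initial value for negative times; this makes the integrand continuous
    on the whole line. *)
Local Notation nE2 := (fun s : R => sup_norm L (E (Num.max 0 s)) ^+ 2).

Lemma continuous_sup_norm_field : continuous nE2.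
Proof.
have max0 (s : R) : 0 <= Num.max 0 s by rewrite le_max lexx.
move=> t; apply: (continuous_comp (f := fun s : R => sup_norm L (E (Num.max 0 s)))
  (g := fun x => x ^+ 2)); last exact: exprn_continuous.
apply/subr_cvg0/norm_cvg0P.
apply: (@squeeze_cvgr _ _ _ _ (fun _ => 0)
  (fun s : R => sup_norm L (E (Num.max 0 s) \- E (Num.max 0 t)))).
- near=> s; rewrite normr_ge0/=.
  by apply: sup_norm_dist; exact: field_ub.
- exact: cvg_cst.
case: field_E => _ _ /(_ (Num.max 0 t) (max0 t)); apply: cvg_comp.
move=> A /= hA.
have cm : {for t, continuous (fun s : R => Num.max 0 s)}.
  by apply: continuous_max; [exact: cvg_cst|exact: cvg_id].
have := cm _ hA; rewrite /= !nbhs_simpl/=.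
by apply: filterS => s /=; apply; rewrite /= in_itv/= max0.
Unshelve. all: by end_near. Qed.

Local Notation I := (fun t : R => \int[mu]_(s in `[0, t]) (sup_norm L (E s) ^+ 2)).

Lemma scaling_base_gt0 t : 0 < 1 + gamma * alpha0 ^+ 2 * I t.
Proof.
have I0 : 0 <= I t by apply: Rintegral_ge0 => s _; rewrite sqr_ge0.
by rewrite ltr_pwDl// !mulr_ge0// ?sqr_ge0 ?ltW.
Qed.

Lemma scaling_gt0 t : 0 < scaling L alpha0 gamma E t.
Proof. by rewrite mulr_gt0// powR_gt0// scaling_base_gt0. Qed.

Lemma is_tderive_scaling (t : R) : 0 <= t ->
  is_tderive (scaling L alpha0 gamma E) t
    (- (gamma / 2) * sup_norm L (E t) ^+ 2 * scaling L alpha0 gamma E t ^+ 3).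
Proof.
(* Starting the primitive at [-1] makes [0] an interior point, so [G] has a two-sided derivative
   even at [t = 0]; [G s - G 0] recovers the integral from [0]. *)
move=> t0; pose G x := \int[mu]_(s in `[-1, x]) nE2 s.
have iG x : mu.-integrable `[-1, x] (EFin \o nE2).
  apply: continuous_compact_integrable; first exact: segment_compact.
  by apply: continuous_subspaceT; exact: continuous_sup_norm_field.
have IG s : 0 <= s -> G s - G 0 = I s.
  move=> s0; rewrite /G Rintegral_itvB//= ?bnd_simp ?lerN10//.
  rewrite Rintegral_itv_obnd_cbnd; last first.
    apply: integrableS (iG s) => //; apply: subset_itvr; rewrite bnd_simp.
    exact: lerN10.
  apply: eq_Rintegral => u; rewrite inE/= in_itv/= => /andP[u0 _].
  by rewrite (max_idPr u0).
have dG : is_derive t (1 : R) G (sup_norm L (E t) ^+ 2).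
  have [| | |dG G't] := @continuous_FTC1_closed _ nE2 (-1) t (t + 1) _ (iG _).
  - by rewrite ltrDl.
  - by rewrite (lt_le_trans _ t0)// ltrN10.
  - exact: continuous_sup_norm_field.
  apply: DeriveDef => //.
  by rewrite -derive1E G't (max_idPr t0).
pose B x := 1 + gamma * alpha0 ^+ 2 * (G x - G 0).
have BI s : 0 <= s -> B s = 1 + gamma * alpha0 ^+ 2 * I s.
  by move=> s0; rewrite /B IG.
have B0 : 0 < B t by rewrite BI// scaling_base_gt0.
have dB : is_derive t (1 : R) B (gamma * alpha0 ^+ 2 * sup_norm L (E t) ^+ 2).
  apply: is_derive_eq.
  by rewrite /= /GRing.scale /=; ring.
have d1 : is_derive t (1 : R) (fun x => B x `^ (- 2^-1))
   (- 2^-1 * B t `^ (- 2^-1 - 1) * (gamma * alpha0 ^+ 2 * sup_norm L (E t) ^+ 2)).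
  have dp := is_derive1_powR (- 2^-1) B0.
  exact: (is_derive1_comp (f := fun x => x `^ (- 2^-1)) (g := B)).
have d2 := is_tderiveZ (c := alpha0) (is_derive_is_tderive d1).
apply: (@eq_is_tderive _ (fun x => alpha0 * B x `^ (- 2^-1))) => //.
  by move=> s s0; rewrite /scaling BI.
suff -> : - (gamma / 2) * sup_norm L (E t) ^+ 2 * scaling L alpha0 gamma E t ^+ 3
  = alpha0 * (- 2^-1 * B t `^ (- 2^-1 - 1) *
      (gamma * alpha0 ^+ 2 * sup_norm L (E t) ^+ 2))
  by exact: d2.
have -> : scaling L alpha0 gamma E t = alpha0 * B t `^ (- 2^-1).
  by rewrite /scaling BI.
(* The exponent [- 3 / 2] is three times [- 1 / 2]: this is the cube of [alpha] in its differential
   equation. *)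
have -> : B t `^ (- 2^-1 - 1) = (B t `^ (- 2^-1)) ^+ 3.
  by rewrite -powR_mulrn ?powR_ge0// -powRrM; congr powR; field.
by field.
Qed.

End Scaling.

(** * Integrals over cells and meshes *)

Section CellIntegrals.
Context {R : realType}.
Local Notation mu := (@lebesgue_measure R).
Implicit Types (f g : R -> R) (a b c : R) (p q : {poly R}).

(** A DG function is prescribed only inside each cell. The arbitrary values at the two endpoints
    harm neither measurability nor, below, integrals. *)
Lemma measurable_fun_eq_itvoo f g a b : {in `]a, b[, f =1 g} ->
  measurable_fun `[a, b] g -> measurable_fun `[a, b] f.
Proof.
move=> fg mg; apply: (@measurable_fun_itv_cc _ a b false true).
apply: (eq_measurable_fun g).
  by move=> y; rewrite inE/= => yab; rewrite fg.
apply: measurable_funS mg => //; exact: subset_itv_oo_cc.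
Qed.

Lemma integral_itvoo_itvcc f a b : measurable_fun `[a, b] f ->
  (\int[mu]_(y in `]a, b[) (f y)%:E = \int[mu]_(y in `[a, b]) (f y)%:E)%E.
Proof.
move=> mf; have ms (A : set R) : A `<=` `[a, b] -> measurable_fun A (EFin \o f).
  by move=> Aab; apply/measurable_EFinP; apply: measurable_funS mf.
rewrite integral_itv_obnd_cbnd; last by apply: ms; exact: subset_itv_oo_cc.
by rewrite integral_itv_bndo_bndc//; apply: ms; exact: subset_itv_co_cc.
Qed.

Lemma eq_integral_itvoo f g a b : {in `]a, b[, f =1 g} ->
  measurable_fun `[a, b] g ->
  (\int[mu]_(y in `[a, b]) (f y)%:E = \int[mu]_(y in `[a, b]) (g y)%:E)%E.
Proof.
move=> fg mg; rewrite -!integral_itvoo_itvcc//.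
  by apply: eq_integral => y; rewrite inE/= => yab; rewrite fg.
exact: measurable_fun_eq_itvoo mg.
Qed.

Lemma eq_Rintegral_itvoo f g a b : {in `]a, b[, f =1 g} ->
  measurable_fun `[a, b] g ->
  \int[mu]_(y in `[a, b]) f y = \int[mu]_(y in `[a, b]) g y.
Proof. by move=> fg mg; congr fine; exact: eq_integral_itvoo. Qed.

Lemma eq_integrable_itvoo f g a b : {in `]a, b[, f =1 g} ->
  mu.-integrable `[a, b] (EFin \o g) -> mu.-integrable `[a, b] (EFin \o f).
Proof.
move=> fg /integrableP[mg ig].
have mg' : measurable_fun `[a, b] g by exact/measurable_EFinP.
apply/integrableP; split.
  by apply/measurable_EFinP; exact: measurable_fun_eq_itvoo mg'.
move: ig; rewrite /= (@eq_integral_itvoo (Num.norm \o f) (Num.norm \o g))//.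
  by move=> y yab /=; rewrite fg.
exact: measurableT_comp.
Qed.

Lemma integrable_setU (A B : set R) (f : R -> \bar R) :
  measurable A -> measurable B -> [disjoint A & B] ->
  mu.-integrable A f -> mu.-integrable B f -> mu.-integrable (A `|` B) f.
Proof.
move=> mA mB AB /integrableP[mAf iA] /integrableP[mBf iB]; apply/integrableP; split.
  exact/measurable_funU.
rewrite ge0_integral_setU//; first exact: lte_add_pinfty.
by apply: measurableT_comp => //; exact/measurable_funU.
Qed.

Lemma measurable_horner p (A : set R) : measurable A -> measurable_fun A (horner p).
Proof.
move=> mA; apply: measurable_funTS; apply: continuous_measurable_fun.
exact: continuous_horner.
Qed.

Lemma integrable_horner p a b : mu.-integrable `[a, b] (EFin \o horner p).
Proof.
apply: continuous_compact_integrable; first exact: segment_compact.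
by apply: continuous_subspaceT; exact: continuous_horner.
Qed.

Definition poly_integral a b p : R := \int[mu]_(y in `[a, b]) p.[y].

Lemma poly_integral_deriv p a b : a < b ->
  poly_integral a b p^`() = p.[b] - p.[a].
Proof.
move=> ab; have cp : continuous (horner p) by exact: continuous_horner.
rewrite /poly_integral /Rintegral (@continuous_FTC2 _ (horner p^`()) (horner p))//.
- by apply: continuous_subspaceT; exact: continuous_horner.
- split=> [y _| |]; first exact: derivable_horner.
  + by apply: cvg_at_right_filter; exact: cp.
  + by apply: cvg_at_left_filter; exact: cp.
- by move=> y _; rewrite -derivE.
Qed.

Definition weighted_integral (e : R -> R) a b p : R :=
  \int[mu]_(y in `[a, b]) (e y * p.[y]).

Section WeightedIntegral.
Variables (e : R -> R) (a b : R) (M : R).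
Hypotheses (me : measurable_fun `[a, b] e) (eM : forall y, a <= y <= b -> `|e y| <= M).
Local Notation Xi := (weighted_integral e a b).

Lemma integrable_weighted p : mu.-integrable `[a, b] (fun y => (e y * p.[y])%:E).
Proof.
apply: (@le_integrable _ _ _ mu _ (measurable_itv _) _
  (fun y => (M%:E * (`|p.[y]|)%:E)%E)).
- by apply/measurable_EFinP; apply: measurable_funM => //; exact: measurable_horner.
- move=> y /=; rewrite in_itv/= => yab; rewrite lee_fin normrM normrM normr_id.
  by rewrite ler_wpM2r//; apply: le_trans (eM yab) (ler_norm _).
- apply: integrableZl => //; exact: (integrable_abse (integrable_horner p a b)).
Qed.

Lemma weighted_integralD p q : Xi (p + q) = Xi p + Xi q.
Proof.
rewrite /weighted_integral -RintegralD//; [|exact: integrable_weighted..].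
by apply: eq_Rintegral => y _; rewrite hornerD mulrDr.
Qed.

Lemma weighted_integralZ c p : Xi (c *: p) = c * Xi p.
Proof.
rewrite /weighted_integral -RintegralZl//; last exact: integrable_weighted.
by apply: eq_Rintegral => y _; rewrite hornerZ mulrCA.
Qed.

Lemma weighted_integral_sum (I : Type) (r : seq I) (P : pred I) (F : I -> {poly R}) :
  Xi (\sum_(i <- r | P i) F i) = \sum_(i <- r | P i) Xi (F i).
Proof.
apply: (big_morph Xi) => [p q|]; first exact: weighted_integralD.
by rewrite -(scale0r 0) weighted_integralZ mul0r.
Qed.

End WeightedIntegral.

Lemma poly_integralE a b : poly_integral a b = weighted_integral (cst 1) a b.
Proof. by apply/funext => p; apply: eq_Rintegral => y _; rewrite mul1r. Qed.

Lemma poly_integralD a b p q :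
  poly_integral a b (p + q) = poly_integral a b p + poly_integral a b q.
Proof.
by rewrite poly_integralE (@weighted_integralD _ _ _ 1)// => y _; rewrite normr1.
Qed.

Lemma poly_integralZ a b c p : poly_integral a b (c *: p) = c * poly_integral a b p.
Proof.
by rewrite poly_integralE (@weighted_integralZ _ _ _ 1)// => y _; rewrite normr1.
Qed.

Lemma poly_integral_sum a b (I : Type) (r : seq I) (P : pred I) (F : I -> {poly R}) :
  poly_integral a b (\sum_(i <- r | P i) F i)
  = \sum_(i <- r | P i) poly_integral a b (F i).
Proof.
by rewrite poly_integralE (@weighted_integral_sum _ _ _ 1)// => y _; rewrite normr1.
Qed.

(** Integrates a pointwise estimate over a cell. The weight [e] will be the electric field, which is
    only bounded and measurable, so its term cannot be merged into a polynomial. *)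
Lemma poly_integral_weighted_le (e : R -> R) a b (M : R) p q r :
  measurable_fun `[a, b] e -> (forall y, a <= y <= b -> `|e y| <= M) ->
  (forall y, a <= y <= b -> p.[y] + e y * q.[y] <= r.[y]) ->
  poly_integral a b p + weighted_integral e a b q <= poly_integral a b r.
Proof.
move=> me eM pqr; rewrite -RintegralD//; last 2 first.
- exact: integrable_horner.
- exact: integrable_weighted eM _.
apply: le_Rintegral => //.
- have := @integrableD _ _ _ mu _ (measurable_itv _) _ _
    (integrable_horner p a b) (integrable_weighted me eM q).
  by apply: eq_integrable.
- exact: integrable_horner.
Qed.

End CellIntegrals.

(** * Integrals and traces of piecewise polynomials *)

Section Mesh.
Context {R : realType}.
Local Notation mu := (@lebesgue_measure R).
Implicit Types (x : nat -> R) (f u : R -> R) (p : {poly R}).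

Lemma mesh_le_last x m : (forall i, (i < m)%N -> x i < x i.+1) ->
  forall i, (i <= m)%N -> x i <= x m.
Proof.
elim: m => [|m IH] xlt i; first by rewrite leqn0 => /eqP->.
rewrite leq_eqVlt => /predU1P[->//|]; rewrite ltnS => im.
apply: (le_trans (IH _ i im)); last exact: ltW (xlt m _).
by move=> k km; apply: xlt; exact: ltnW.
Qed.

Lemma mesh_ge_first x m : (forall i, (i < m)%N -> x i < x i.+1) ->
  forall i, (i <= m)%N -> x 0%N <= x i.
Proof.
move=> xlt i im; apply: mesh_le_last (leq0n i) => j ji; apply: xlt.
exact: leq_trans im.
Qed.

(** Integrability belongs to the conclusion because the induction adds one cell at a time, and
    additivity of the real-valued integral requires it. *)
Lemma mesh_integral x m f (p : nat -> {poly R}) :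
  (forall i, (i < m)%N -> x i < x i.+1) ->
  (forall j, (j < m)%N -> {in `]x j, x j.+1[, f =1 horner (p j)}) ->
  mu.-integrable `[x 0%N, x m] (EFin \o f) /\
  \int[mu]_(y in `[x 0%N, x m]) f y
  = \sum_(j < m) poly_integral (x j) (x j.+1) (p j).
Proof.
elim: m => [|m IH] xlt fp.
  split; last by rewrite set_itv1 Rintegral_set1 big_ord0.
  apply: (@eq_integrable_itvoo _ f (horner 0)); last exact: integrable_horner.
  by move=> y; rewrite in_itv/= => /andP[/lt_trans h /h]; rewrite ltxx.
have xlt' i : (i < m)%N -> x i < x i.+1 by move=> im; apply: xlt; exact: ltnW.
have [] := IH xlt' (fun j jm => fp j (ltnW jm)).
move=> if1 if2.
have x0m : x 0%N <= x m by exact: mesh_ge_first xlt' _ _.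
have xm := xlt m (ltnSn m).
have if3 : mu.-integrable `[x m, x m.+1] (EFin \o f).
  exact: eq_integrable_itvoo (fp m (ltnSn m)) (integrable_horner _ _ _).
have if4 : mu.-integrable `]x m, x m.+1] (EFin \o f).
  by apply: integrableS if3 => //; exact: subset_itv_oc_cc.
have dj : [disjoint `[x 0%N, x m]%classic & `]x m, x m.+1]%classic].
  apply/disj_setPS => y [/=]; rewrite 2!in_itv/= => /andP[_ yx] /andP[].
  by rewrite ltNge yx.
have E : `[x 0%N, x m.+1]%classic = `[x 0%N, x m] `|` `]x m, x m.+1].
  by rewrite -itv_bndbnd_setU// bnd_simp// ltW.
have if5 : mu.-integrable (`[x 0%N, x m] `|` `]x m, x m.+1]) (EFin \o f).
  exact: integrable_setU.
rewrite E; split=> //; rewrite Rintegral_setU// big_ord_recr/= -if2; congr (_ + _).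
rewrite Rintegral_itv_obnd_cbnd//; apply: eq_Rintegral_itvoo; first exact: fp.
exact: measurable_horner.
Qed.

Section Traces.
Variables (Nx : nat) (x : nat -> R).
Hypothesis xlt : forall i, (i < Nx)%N -> x i < x i.+1.

Lemma trace_plus_horner u p j : (j < Nx)%N ->
  {in `]x j, x j.+1[, u =1 horner p} -> trace_plus Nx x u j = p.[x j].
Proof.
move=> jN up; rewrite /trace_plus ltn_eqF//; apply: cvg_lim => //.
have : p.[y] @[y --> (x j)^'+] --> p.[x j].
  by apply: cvg_at_right_filter; exact: continuous_horner.
apply: cvg_trans; apply: near_eq_cvg; near=> y; apply/esym/up.
rewrite in_itv/=; apply/andP; split; near: y; first exact: nbhs_right_gt.
by apply: nbhs_right_lt; exact: xlt.
Unshelve. all: by end_near. Qed.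

Lemma trace_minus_horner u p j : (j < Nx)%N ->
  {in `]x j, x j.+1[, u =1 horner p} -> trace_minus Nx x u j.+1 = p.[x j.+1].
Proof.
move=> jN up; rewrite /trace_minus /=; apply: cvg_lim => //.
have : p.[y] @[y --> (x j.+1)^'-] --> p.[x j.+1].
  by apply: cvg_at_left_filter; exact: continuous_horner.
apply: cvg_trans; apply: near_eq_cvg; near=> y; apply/esym/up.
rewrite in_itv/=; apply/andP; split; near: y; last exact: nbhs_left_lt.
by apply: nbhs_left_gt; exact: xlt.
Unshelve. all: by end_near. Qed.

Lemma trace_plus_periodic u : trace_plus Nx x u Nx = trace_plus Nx x u 0.
Proof. by rewrite /trace_plus eqxx; case: eqP. Qed.

Lemma trace_minus_periodic u : trace_minus Nx x u Nx = trace_minus Nx x u 0.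
Proof. by rewrite /trace_minus eqxx; case: eqP. Qed.

End Traces.

End Mesh.

(** * Time derivatives in polynomial coordinates *)

Section Coordinates.
Context {R : realType}.
Variables (Lam : {poly R} -> R).
Hypothesis LamZ : forall c p, Lam (c *: p) = c * Lam p.
Hypothesis Lam_sum : forall n (F : 'I_n -> {poly R}),
  Lam (\sum_(i < n) F i) = \sum_(i < n) Lam (F i).

Let LamZZ a b p q : Lam (a *: p * (b *: q)) = a * b * Lam (p * q).
Proof. by rewrite -scalerAl -scalerAr !LamZ mulrA. Qed.

Lemma is_tderive_coords n (l : 'I_n -> {poly R}) (c : 'I_n -> R -> R)
    (c' : 'I_n -> R) (p : R -> {poly R}) (q : {poly R}) t : 0 <= t ->
  (forall s, 0 <= s -> p s = \sum_(i < n) c i s *: l i) ->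
  (forall i, is_tderive (c i) t (c' i)) ->
  is_tderive (fun s => Lam (p s * q)) t (Lam ((\sum_(i < n) c' i *: l i) * q)).
Proof.
move=> t0 pE cc'.
apply: (@eq_is_tderive _ (fun s => \sum_(i < n) c i s * Lam (l i * q))) => //.
  move=> s s0; rewrite pE// mulr_suml Lam_sum; apply: eq_bigr => i _.
  by rewrite -scalerAl LamZ.
rewrite mulr_suml Lam_sum; apply: is_tderive_sum => i _.
rewrite -scalerAl LamZ.
by have := is_tderiveM (cc' i) (is_tderive_cst (Lam (l i * q)) t); rewrite mulr0 addr0.
Qed.

(** Both factors move here. In coordinates the square is a quadratic form with constant matrix [T];
    its symmetry makes the two halves of the product rule equal, hence the factor [2]. *)
Lemma is_tderive_coords_sqr n (l : 'I_n -> {poly R}) (c : 'I_n -> R -> R)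
    (c' : 'I_n -> R) (p : R -> {poly R}) t : 0 <= t ->
  (forall s, 0 <= s -> p s = \sum_(i < n) c i s *: l i) ->
  (forall i, is_tderive (c i) t (c' i)) ->
  is_tderive (fun s => Lam (p s * p s)) t
    (2 * Lam ((\sum_(i < n) c' i *: l i) * p t)).
Proof.
move=> t0 pE cc'.
pose T i j := Lam (l i * l j).
apply: (@eq_is_tderive _
  (fun s => \sum_(i < n) \sum_(j < n) (c i s * c j s) * T i j)) => //.
  move=> s s0; rewrite pE// mulr_suml Lam_sum; apply: eq_bigr => i _.
  rewrite mulr_sumr Lam_sum; apply: eq_bigr => j _.
  by rewrite LamZZ.
have -> : 2 * Lam ((\sum_(i < n) c' i *: l i) * p t) =
    \sum_(i < n) \sum_(j < n) (c' i * c j t + c i t * c' j) * T i j.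
  under [RHS]eq_bigr do under eq_bigr do rewrite mulrDl.
  under [RHS]eq_bigr do rewrite big_split.
  rewrite big_split /= mulr_natl mulr2n; congr (_ + _); last rewrite exchange_big/=.
    rewrite pE// mulr_suml Lam_sum; apply: eq_bigr => i _.
    rewrite mulr_sumr Lam_sum; apply: eq_bigr => j _.
    by rewrite LamZZ.
  rewrite pE// mulr_suml Lam_sum; apply: eq_bigr => i _.
  rewrite mulr_sumr Lam_sum; apply: eq_bigr => j _.
  by rewrite LamZZ /T [l j * _]mulrC [c j t * _]mulrC.
apply: is_tderive_sum => i _; apply: is_tderive_sum => j _.
have := is_tderiveM (is_tderiveM (cc' i) (cc' j)) (is_tderive_cst (T i j) t).
by rewrite mulr0 addr0.
Qed.

End Coordinates.

(** * Sums over the Hermite index *)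

Section HermiteCoefficients.
Context {R : realType}.
Local Notation rt n := (Num.sqrt n%:R : R).

(** Summation by parts in the Hermite index: factors [sqrt 0] kill the lower boundary term,
    truncation kills the upper one. *)
Lemma sum_ord_shift (V : zmodType) (h : nat -> V) n : h 0%N = 0 -> h n = 0 ->
  \sum_(i < n) h i.+1 = \sum_(i < n) h i.
Proof.
move=> h0 hn; have := erefl (\sum_(i < n.+1) h i).
rewrite {1}big_ord_recl big_ord_recr/= h0 hn add0r addr0 => <-.
by apply: eq_bigr.
Qed.

Variable NH : nat.

(** The coefficient of index [n] of the product of the variable with the Hermite expansion of
    coefficients [c]. *)
Definition flux_coef (c : nat -> R) n : R := rt n.+1 * c n.+1 + rt n * c n.-1.

Section Vanishing.
Variable c : nat -> R.
Hypothesis c0 : forall n, (NH <= n)%N -> c n = 0.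

(** Expand [flux_coef c n ^+ 2] and shift its first square and its cross term down by one index, its
    second square up. The extra [c n ^+ 2], which in the energy comes from differentiating the
    prefactor [alpha], is exactly what makes the sum one of squares. *)
Lemma sum_stretch :
  \sum_(n < NH) (c n ^+ 2 + 2 * ((n%:R * c n + Num.sqrt (n.-1 * n)%:R * c n.-2) * c n))
  = \sum_(n < NH.+1) flux_coef c n ^+ 2.
Proof.
pose h1 n := n%:R * c n ^+ 2.
pose h3 n := 2 * (Num.sqrt (n.-1 * n)%:R * c n.-2 * c n).
transitivity (\sum_(n < NH.+1) h1 n.+1 + \sum_(n < NH.+1) n%:R * c n.-1 ^+ 2
    + \sum_(n < NH.+1) h3 n.+1).
  have h10 : h1 0%N = 0 by rewrite /h1 mul0r.
  have h1N : h1 NH.+1 = 0 by rewrite /h1 c0// expr0n mulr0.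
  have h30 : h3 0%N = 0 by rewrite /h3 muln0 sqrtr0 !(mul0r, mulr0).
  have h3N : h3 NH.+1 = 0 by rewrite /h3 [c NH.+1]c0// !mulr0.
  rewrite !sum_ord_shift// /h1 /h3.
  rewrite [X in X + _ + _]big_ord_recr [X in _ + X + _]big_ord_recl.
  rewrite [X in _ + _ + X]big_ord_recr /= [c NH]c0// expr0n /= !(mul0r, mulr0) !addr0 add0r -!big_split/=.
  by apply: eq_bigr => n _; rewrite /bump /= add1n -natr1; ring.
rewrite -!big_split; apply: eq_bigr => n _ /=.
rewrite /h1 /h3 /flux_coef /= natrM sqrtrM ?ler0n//.
have e k : k%:R = rt k ^+ 2 by rewrite sqr_sqrtr ?ler0n.
rewrite [in n.+1%:R * _]e [in n%:R * _ ^+ 2]e; ring.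
Qed.

Lemma sum_drive :
  \sum_(n < NH) 2 * (rt n * (c n.-1 * c n)) = \sum_(n < NH.+1) c n * flux_coef c n.
Proof.
pose h n := rt n * (c n.-1 * c n).
transitivity (\sum_(n < NH.+1) h n.+1 + \sum_(n < NH.+1) h n).
  rewrite sum_ord_shift /h ?sqrtr0 ?mul0r ?[c NH.+1]c0 ?mulr0//.
  rewrite -big_split big_ord_recr/= [c NH]c0// !mulr0 !addr0.
  by apply: eq_bigr => n _; ring.
by rewrite -big_split; apply: eq_bigr => n _; rewrite /h /flux_coef /=; ring.
Qed.

(* Completing the square: [alpha / (2 gamma) (c_n - gamma alpha e S)^2 >= 0]
   with [S = flux_coef c n]. *)
Lemma stretch_drive_le (a gamma M e : R) : 0 < a -> 0 < gamma -> `|e| <= M ->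
  \sum_(n < NH) (- (gamma / 2) * M ^+ 2 * a ^+ 3 *
      (c n ^+ 2 + 2 * ((n%:R * c n + Num.sqrt (n.-1 * n)%:R * c n.-2) * c n))
    + 2 * a ^+ 2 * (rt n * (e * (c n.-1 * c n))))
  <= \sum_(n < NH) a / (2 * gamma) * c n ^+ 2.
Proof.
move=> a0 g0 eM.
(* Padding with the zero term at [NH] matches the range of [flux_coef]. *)
have -> : \sum_(n < NH) a / (2 * gamma) * c n ^+ 2
    = \sum_(n < NH.+1) a / (2 * gamma) * c n ^+ 2.
  by rewrite big_ord_recr/= c0// expr0n mulr0 addr0.
rewrite big_split/= -mulr_sumr sum_stretch.
have -> : \sum_(n < NH) 2 * a ^+ 2 * (rt n * (e * (c n.-1 * c n)))
    = a ^+ 2 * e * \sum_(n < NH.+1) c n * flux_coef c n.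
  by rewrite -sum_drive mulr_sumr; apply: eq_bigr => n _; ring.
rewrite !mulr_sumr -big_split; apply: ler_sum => n _ /=.
set S := flux_coef c n; set d := c n.
have e2 : e ^+ 2 <= M ^+ 2.
  by rewrite -[e ^+ 2]real_normK ?num_real// lerXn2r ?nnegrE// (le_trans _ eM)//.
have h1 : 0 <= a / (2 * gamma) * (d - gamma * a * e * S) ^+ 2.
  by rewrite mulr_ge0 ?sqr_ge0// ltW// divr_gt0// mulr_gt0.
(* The square [h1] uses the local field [e], whereas the stretching term carries the bound [M]; [h2]
   is the surplus. *)
have h2 : 0 <= gamma / 2 * a ^+ 3 * S ^+ 2 * (M ^+ 2 - e ^+ 2).
  rewrite mulr_ge0 ?subr_ge0// mulr_ge0 ?sqr_ge0// ltW//.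
  by rewrite mulr_gt0 ?exprn_gt0 ?divr_gt0.
have := addr_ge0 h1 h2; rewrite -subr_ge0.
congr (0 <= _); field; rewrite gt_eqF//.
Qed.

End Vanishing.

(** For truncated [c], half the pairing of [c] with its flux [a^-1 * flux_coef c]; [flux_poly_deriv]
    shows it to be a primitive of the volume term. *)
Definition flux_potential (a : R) (c : nat -> R) : R :=
  a^-1 * \sum_(n < NH) rt n * (c n * c n.-1).

(** The potential is quadratic, so its jump is exactly the mean of its gradient, the central flux,
    times the jump of [c]. Only the penalty part of the numerical flux is left. *)
Lemma numerical_flux_dissipation (a : R) (d cm cp : nat -> R) :
  (forall n, (NH <= n)%N -> cm n = 0) -> (forall n, (NH <= n)%N -> cp n = 0) ->
  \sum_(n < NH) 2^-1 * (a^-1 * flux_coef cm n + a^-1 * flux_coef cp n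
      - d n * (cp n - cm n)) * (cm n - cp n)
    - flux_potential a cm + flux_potential a cp
  = \sum_(n < NH) 2^-1 * (d n * (cp n - cm n) ^+ 2).
Proof.
move=> cm0 cp0.
pose h n := rt n * ((cm n + cp n) * (cm n.-1 - cp n.-1)).
have hS : \sum_(n < NH) h n.+1 = \sum_(n < NH) h n.
  by apply: sum_ord_shift; rewrite /h ?sqrtr0 ?mul0r// cm0// cp0// addr0 mul0r mulr0.
rewrite /flux_potential !mulr_sumr -sumrN -!big_split/=.
apply/eqP; rewrite -subr_eq0 -sumrB; apply/eqP.
transitivity (2^-1 * a^-1 * (\sum_(n < NH) h n.+1 - \sum_(n < NH) h n)).
  rewrite -sumrB mulr_sumr; apply: eq_bigr => n _.
  by rewrite /h /flux_coef /=; set b := a^-1; field.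
by rewrite hS subrr mulr0.
Qed.

(** The coupling of neighbouring indices is symmetric: one shift pairs [P n * (P n.-1)^]()[with]P
    n.-1 * (P n)^[()], completing a product rule. *)
Lemma flux_poly_deriv (a : R) (P : nat -> {poly R}) :
  (forall n, (NH <= n)%N -> P n = 0) ->
  \sum_(n < NH) (a^-1 *: (rt n.+1 *: P n.+1 + rt n *: P n.-1)) * (P n)^`()
  = (a^-1 *: \sum_(n < NH) rt n *: (P n * P n.-1))^`().
Proof.
move=> P0; pose h n := rt n *: (P n * (P n.-1)^`()).
have hS : \sum_(n < NH) h n.+1 = \sum_(n < NH) h n.
  by apply: sum_ord_shift; rewrite /h ?sqrtr0 ?scale0r// P0// mul0r scaler0.
rewrite derivZ raddf_sum.
transitivity (a^-1 *: (\sum_(n < NH) h n.+1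
    + \sum_(n < NH) rt n *: (P n.-1 * (P n)^`()))).
  rewrite -big_split scaler_sumr; apply: eq_bigr => n _ /=.
  by rewrite -scalerAl mulrDl -!scalerAl.
rewrite hS -big_split; congr (_ *: _); apply: eq_bigr => n _ /=.
by rewrite derivZ derivM -scalerDr [_^`() * _]mulrC addrC.
Qed.

End HermiteCoefficients.

(** * Lagrange interpolation inside a cell *)

Section Interpolation.
Context {R : realType}.

Lemma interpolation_nodes (a b : R) (n : nat) : a < b ->
  exists (y : 'I_n.+1 -> R) (l : 'I_n.+1 -> {poly R}),
    (forall i, y i \in `]a, b[) /\
    (forall p : {poly R}, (size p <= n.+1)%N -> p = \sum_(i < n.+1) p.[y i] *: l i).
Proof.
(* The denominators start at [2] to keep the nodes strictly inside, where regularity in time is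
   available. *)
move=> ab; pose y (i : nat) := a + (b - a) / i.+2%:R.
have ba0 : 0 < b - a by rewrite subr_gt0.
have y_inj : injective y.
  move=> i j /addrI /(mulfI (lt0r_neq0 ba0)) /invr_inj /eqP.
  by rewrite eqr_nat => /eqP[].
exists (fun i => y i), (fun i => val (tnth (lagrange n.+1 y) i)); split.
  move=> i; rewrite in_itv/= /y ltrDl divr_gt0//= -ltrBrDl.
  by rewrite ltr_pdivrMr// ltr_pMr// ltr1n.
move=> p sp; rewrite {1}(lagrange_gen (ltn0Sn n) y_inj sp).
by apply: eq_bigr => i _; rewrite mul_polyC.
Qed.

End Interpolation.

(** * The energy of a discrete solution *)

Section Energy.
Context {R : realType}.
Local Notation mu := (@lebesgue_measure R).
Variables (L alpha0 gamma : R) (Nx : nat) (x : nat -> R) (NH k : nat).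
Variables (E : R -> R -> R) (C : nat -> R -> R -> R).
Hypotheses (L_gt0 : 0 < L) (alpha0_gt0 : 0 < alpha0) (gamma_gt0 : 0 < gamma).
Hypothesis mesh_x : mesh L Nx x.
Hypothesis field_E : admissible_field L E.
Local Notation alpha := (scaling L alpha0 gamma E).
Hypothesis sol_C : dg_solution NH Nx x alpha k E C.

(** Choice turns the polynomials of [dg_space] into one family. For [n >= NH] it is the zero
    polynomial, so truncation can be used as an identity in [{poly R}]. *)
Lemma cell_polynomials : exists P : nat -> nat -> R -> {poly R},
  (forall n j t, (NH <= n)%N -> P n j t = 0) /\
  (forall n j t, (j < Nx)%N -> 0 <= t ->
     (size (P n j t) <= k.+1)%N /\ {in `]x j, x j.+1[, C n t =1 horner (P n j t)}).
Proof.
have h n : exists Q : nat * R -> {poly R}, (forall jt, (NH <= n)%N -> Q jt = 0) /\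
    (forall jt, (jt.1 < Nx)%N -> 0 <= jt.2 -> (size (Q jt) <= k.+1)%N /\
       {in `]x jt.1, x jt.1.+1[, C n jt.2 =1 horner (Q jt)}).
  have [nN|nN] := leqP NH n.
    exists (fun=> 0); split=> // -[j t] _ _; rewrite size_poly0; split=> // y _.
    by rewrite (dg_ge_NH sol_C)// horner0.
  have /choice[Q HQ] : forall jt : nat * R, exists q : {poly R},
      (jt.1 < Nx)%N -> 0 <= jt.2 -> (size q <= k.+1)%N /\
       {in `]x jt.1, x jt.1.+1[, C n jt.2 =1 horner q}.
    move=> [j t] /=; have [jN|] := ltnP j Nx; last by exists 0.
    have [t0|] := lerP 0 t; last by exists 0.
    by have [q sq qC] := dg_in_space sol_C nN t0 jN; exists q.
  by exists Q; split=> // jt; rewrite leqNgt nN.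
have /choice[Q HQ] := h; exists (fun n j t => Q n (j, t)); split.
  by move=> n j t; exact: (HQ n).1.
by move=> n j t; exact: (HQ n).2 (j, t).
Qed.

Variable P : nat -> nat -> R -> {poly R}.
Hypothesis P_ge : forall n j t, (NH <= n)%N -> P n j t = 0.
Hypothesis P_cell : forall n j t, (j < Nx)%N -> 0 <= t ->
  (size (P n j t) <= k.+1)%N /\ {in `]x j, x j.+1[, C n t =1 horner (P n j t)}.

Local Notation Lam j := (poly_integral (x j) (x j.+1)).
Local Notation Xi t j := (weighted_integral (E t) (x j) (x j.+1)).
Local Notation rt n := (Num.sqrt n%:R : R).

Let x_lt j : (j < Nx)%N -> x j < x j.+1.
Proof. by case: mesh_x => _ _; apply. Qed.

Let Nx_gt0 : (0 < Nx)%N.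
Proof.
case: mesh_x => x0 xN _; rewrite lt0n; apply/eqP => N0.
by move: L_gt0; rewrite -xN N0 x0 ltxx.
Qed.

Let PC n j t : (j < Nx)%N -> 0 <= t -> {in `]x j, x j.+1[, C n t =1 horner (P n j t)}.
Proof. by move=> jN t0; have [] := P_cell n jN t0. Qed.

Let alpha_gt0 t : 0 < alpha t.
Proof. exact: scaling_gt0. Qed.

Let field_cell t j : (j < Nx)%N -> 0 <= t -> measurable_fun `[x j, x j.+1] (E t) /\
  (forall y, x j <= y <= x j.+1 -> `|E t y| <= sup_norm L (E t)).
Proof.
move=> jN t0; case: mesh_x => x0 xN _; case: field_E => mE uE _.
have xj0 : 0 <= x j by rewrite -x0; apply: (mesh_ge_first x_lt); exact: ltnW.
have xjL : x j.+1 <= L by rewrite -xN; exact: (mesh_le_last x_lt).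
split.
  apply: measurable_funS (mE t t0) => //; apply: subset_itv; rewrite bnd_simp//.
move=> y /andP[jy yj]; apply: sup_norm_ub; first exact: uE.
by rewrite (le_trans xj0 jy) (le_trans yj xjL).
Qed.

(** The scheme solved for its time derivative. [phi] is the test function as a function, as
    [dg_form] requires; [q] is its polynomial on cell [j]. *)
Definition cell_balance n j t phi (q : {poly R}) : R :=
  time_derive alpha t / alpha t *
    Lam j ((n%:R *: P n j t + Num.sqrt (n.-1 * n)%:R *: P n.-2 j t) * q)
  - dg_form NH Nx x alpha C n t j phi
  + alpha t * rt n * Xi t j (P n.-1 j t * q).

Lemma cell_coef_tderive n j t : (n < NH)%N -> (j < Nx)%N -> 0 <= t ->
  exists D : {poly R},
    (forall q, is_tderive (fun s => Lam j (P n j s * q)) t (Lam j (D * q))) /\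
    is_tderive (fun s => Lam j (P n j s * P n j s)) t (2 * Lam j (D * P n j t)).
Proof.
move=> nN jN t0; have [y [l [yI pE]]] := interpolation_nodes k (x_lt jN).
have cE s : 0 <= s -> P n j s = \sum_(i < k.+1) C n s (y i) *: l i.
  move=> s0; rewrite {1}[P n j s]pE; last exact: (P_cell n jN s0).1.
  by apply: eq_bigr => i _; rewrite (PC n jN s0).
have dC i : is_tderive (fun s => C n s (y i)) t (time_derive (fun s => C n s (y i)) t).
  apply: time_derivableP.
  by have [h _] := dg_C1 sol_C nN jN (yI i); exact: h.
have LS m (F : 'I_m -> {poly R}) :
    Lam j (\sum_(i < m) F i) = \sum_(i < m) Lam j (F i).
  exact: poly_integral_sum.
exists (\sum_(i < k.+1) time_derive (fun s => C n s (y i)) t *: l i); split.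
  by move=> q; exact: (is_tderive_coords (poly_integralZ _ _) LS t0 cE dC).
exact: (is_tderive_coords_sqr (poly_integralZ _ _) LS t0 cE dC).
Qed.

Lemma cell_balanceE n j t phi q (D : {poly R}) :
  (n < NH)%N -> (j < Nx)%N -> 0 <= t ->
  dg_space Nx x k phi -> {in `]x j, x j.+1[, phi =1 horner q} ->
  is_tderive (fun s => Lam j (P n j s * q)) t (Lam j (D * q)) ->
  Lam j (D * q) = cell_balance n j t phi q.
Proof.
move=> nN jN t0 phiV phiq dD.
have [mE bE] := field_cell jN t0.
have := dg_equation sol_C nN jN phiV t0.
have -> : time_derive (fun s => \int[mu]_(y in cell x j) (C n s y * phi y)) t
    = Lam j (D * q).
  apply: (is_tderive_lim t0); apply: eq_is_tderive t0 _ dD => s s0.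
  apply/esym/eq_Rintegral_itvoo; last exact: measurable_horner.
  by move=> y yI; rewrite hornerM (PC n jN s0)// phiq.
have -> : \int[mu]_(y in cell x j)
        ((n%:R * C n t y + Num.sqrt (n.-1 * n)%:R * C n.-2 t y) * phi y)
    = Lam j ((n%:R *: P n j t + Num.sqrt (n.-1 * n)%:R *: P n.-2 j t) * q).
  apply/eq_Rintegral_itvoo; last exact: measurable_horner.
  by move=> y yI; rewrite hornerM hornerD !hornerZ !(PC _ jN t0)// phiq.
have -> : \int[mu]_(y in cell x j) (E t y * C n.-1 t y * phi y)
    = Xi t j (P n.-1 j t * q).
  apply/eq_Rintegral_itvoo; last first.
    by apply: measurable_funM => //; exact: measurable_horner.
  by move=> y yI; rewrite hornerM mulrA !(PC _ jN t0)// phiq.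
by rewrite /cell_balance => h; apply/eqP; rewrite -subr_eq0 -h; apply/eqP; ring.
Qed.

Lemma cell_balance_tderive n j t phi q :
  (n < NH)%N -> (j < Nx)%N -> 0 <= t ->
  dg_space Nx x k phi -> {in `]x j, x j.+1[, phi =1 horner q} ->
  is_tderive (fun s => Lam j (P n j s * q)) t (cell_balance n j t phi q).
Proof.
move=> nN jN t0 phiV phiq; have [D [h _]] := cell_coef_tderive nN jN t0.
by rewrite -(cell_balanceE nN jN t0 phiV phiq (h q)).
Qed.

Lemma cell_energy_tderive n j t : (n < NH)%N -> (j < Nx)%N -> 0 <= t ->
  is_tderive (fun s => Lam j (P n j s * P n j s)) t
    (2 * cell_balance n j t (C n t) (P n j t)).
Proof.
move=> nN jN t0; have [D [h hh]] := cell_coef_tderive nN jN t0.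
by rewrite -(cell_balanceE nN jN t0 (dg_in_space sol_C nN t0) (PC n jN t0) (h _)).
Qed.

Local Notation tm t i := (fun n => trace_minus Nx x (C n t) i).
Local Notation tp t i := (fun n => trace_plus Nx x (C n t) i).

Let PtmE n j t : (j < Nx)%N -> 0 <= t -> (P n j t).[x j.+1] = tm t j.+1 n.
Proof. by move=> jN t0; rewrite /= (trace_minus_horner x_lt jN (PC n jN t0)). Qed.

Let PtpE n j t : (j < Nx)%N -> 0 <= t -> (P n j t).[x j] = tp t j n.
Proof. by move=> jN t0; rewrite /= (trace_plus_horner x_lt jN (PC n jN t0)). Qed.

Definition flux_poly n j t : {poly R} :=
  (alpha t)^-1 *: (rt n.+1 *: P n.+1 j t + rt n *: P n.-1 j t).

Lemma flux_fun_horner n j t : (j < Nx)%N -> 0 <= t ->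
  {in `]x j, x j.+1[, flux_fun alpha C n t =1 horner (flux_poly n j t)}.
Proof.
move=> jN t0 y yI; rewrite /flux_fun !(PC _ jN t0)//.
by rewrite hornerZ hornerD !hornerZ.
Qed.

Lemma trace_minus_flux n i t : (i <= Nx)%N -> 0 <= t ->
  trace_minus Nx x (flux_fun alpha C n t) i = (alpha t)^-1 * flux_coef (tm t i) n.
Proof.
have H j : (j < Nx)%N -> 0 <= t ->
    trace_minus Nx x (flux_fun alpha C n t) j.+1
    = (alpha t)^-1 * flux_coef (tm t j.+1) n.
  move=> jN t0; rewrite (trace_minus_horner x_lt jN (flux_fun_horner n jN t0)).
  by rewrite /flux_poly hornerZ hornerD !hornerZ !PtmE.
case: i => [|i] iN t0; last exact: H.
(* The left trace at node [0] is read in the last cell. *)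
rewrite /flux_coef -!trace_minus_periodic.
by have := H Nx.-1; rewrite (prednK Nx_gt0) leqnn; exact.
Qed.

Lemma trace_plus_flux n i t : (i <= Nx)%N -> 0 <= t ->
  trace_plus Nx x (flux_fun alpha C n t) i = (alpha t)^-1 * flux_coef (tp t i) n.
Proof.
have H j : (j < Nx)%N -> 0 <= t ->
    trace_plus Nx x (flux_fun alpha C n t) j = (alpha t)^-1 * flux_coef (tp t j) n.
  move=> jN t0; rewrite (trace_plus_horner x_lt jN (flux_fun_horner n jN t0)).
  by rewrite /flux_poly hornerZ hornerD !hornerZ !PtpE.
rewrite leq_eqVlt => /predU1P[->|iN] t0; last exact: H.
by rewrite /flux_coef !trace_plus_periodic; exact: H.
Qed.

Lemma numerical_fluxE n i t : (i <= Nx)%N -> 0 <= t ->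
  numerical_flux NH Nx x alpha C n t i =
  2^-1 * ((alpha t)^-1 * flux_coef (tm t i) n + (alpha t)^-1 * flux_coef (tp t i) n
          - delta NH alpha n t * (tp t i n - tm t i n)).
Proof. by move=> iN t0; rewrite /numerical_flux trace_minus_flux// trace_plus_flux. Qed.

Lemma numerical_flux_periodic n t :
  numerical_flux NH Nx x alpha C n t Nx = numerical_flux NH Nx x alpha C n t 0.
Proof.
by rewrite /numerical_flux /jump !trace_minus_periodic !trace_plus_periodic.
Qed.

Lemma dg_formE n j t phi q : (j < Nx)%N -> 0 <= t ->
  {in `]x j, x j.+1[, phi =1 horner q} ->
  dg_form NH Nx x alpha C n t j phi =
  - Lam j (flux_poly n j t * q^`())
  + numerical_flux NH Nx x alpha C n t j.+1 * q.[x j.+1]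
  - numerical_flux NH Nx x alpha C n t j * q.[x j].
Proof.
move=> jN t0 phiq; rewrite /dg_form.
rewrite (trace_minus_horner x_lt jN phiq) (trace_plus_horner x_lt jN phiq).
congr (- _ + _ - _); apply: eq_Rintegral_itvoo; last exact: measurable_horner.
move=> y yI; rewrite hornerM (flux_fun_horner n jN t0)//; congr (_ * _).
(* A derivative depends on a neighbourhood: [phi] and [q] agree near each [y] of the open cell. *)
rewrite derivE !derive1E; apply: near_eq_derive.
have : \forall z \near y, z \in `]x j, x j.+1[ by exact: near_in_itvoo.
by apply: filterS => z /phiq.
Qed.

Lemma mass_tderive t : 0 <= t -> (0 < NH)%N ->
  is_tderive (fun s => \int[mu]_(y in `[0, L]) C 0%N s y) t 0.
Proof.
move=> t0 NH0.
have V1 : dg_space Nx x k (cst 1).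
  by move=> j jN; exists 1; [rewrite size_poly1|move=> y _; rewrite hornerC].
have I1 j : {in `]x j, x j.+1[, cst 1 =1 horner (1 : {poly R})}.
  by move=> y _; rewrite hornerC.
apply: (@eq_is_tderive _ (fun s => \sum_(j < Nx) Lam j (P 0%N j s * 1))) => //.
  move=> s s0; case: mesh_x => x0 xN _.
  have [_] := mesh_integral x_lt (fun j jN => PC 0 jN s0); rewrite x0 xN => ->.
  by apply: eq_bigr => j _; rewrite mulr1.
(* At index [0] with a constant test function only the numerical fluxes survive; they telescope to
   the difference of the two identified endpoints. *)
have bal0 : \sum_(j < Nx) cell_balance 0 j t (cst 1) 1 = 0.
  pose nf i := - numerical_flux NH Nx x alpha C 0 t i.
  transitivity (\sum_(j < Nx) (nf j.+1 - nf j)); last first.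
    have := @telescope_sumr _ 0 Nx nf (leq0n _); rewrite big_mkord => ->.
    by rewrite /nf numerical_flux_periodic subrr.
  apply: eq_bigr => j _; rewrite /cell_balance (dg_formE _ _ t0 (I1 j))//.
  rewrite derivC mulr0 muln0 sqrtr0 !scale0r addr0 mul0r !hornerC.
  rewrite mulr0 mul0r addr0 !mulr1.
  rewrite -(scale0r 0) !poly_integralZ !mul0r mulr0 /nf; ring.
rewrite -[X in is_tderive _ _ X]bal0.
by apply: is_tderive_sum => j _; exact: cell_balance_tderive.
Qed.

Lemma sum_dg_form t : 0 <= t ->
  \sum_(j < Nx) \sum_(n < NH) dg_form NH Nx x alpha C n t j (C n t)
  = \sum_(j < Nx) \sum_(n < NH) 2^-1 * (delta NH alpha n t * jump Nx x (C n t) j ^+ 2).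
Proof.
move=> t0.
pose nf n i := numerical_flux NH Nx x alpha C n t i.
(* [f] and [g] collect the left and right data of a node. Cell [j] contributes [f j.+1 - g j], and
   periodicity regroups these as [f j - g j], one interface at a time. *)
pose f i := \sum_(n < NH) nf n i * tm t i n - flux_potential NH (alpha t) (tm t i).
pose g i := \sum_(n < NH) nf n i * tp t i n - flux_potential NH (alpha t) (tp t i).
have fg (j : 'I_Nx) :
    \sum_(n < NH) dg_form NH Nx x alpha C n t j (C n t) = f j.+1 - g j.
  have jN := ltn_ord j.
  under eq_bigr => n _ do rewrite (dg_formE n jN t0 (PC n jN t0)) PtmE// PtpE//.
  rewrite !big_split /= !sumrN -poly_integral_sum.
  rewrite (flux_poly_deriv (alpha t) (P := fun n => P n j t)); last first.
    by move=> n; exact: P_ge.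
  rewrite poly_integral_deriv ?x_lt// !hornerZ !horner_sum.
  rewrite /f /g /flux_potential.
  under [X in _ * X - _]eq_bigr do rewrite hornerZ hornerM !PtmE//.
  under [X in _ - _ * X]eq_bigr do rewrite hornerZ hornerM !PtpE//.
  rewrite /nf; ring.
have fP : f Nx = f 0%N.
  rewrite /f /nf /flux_potential; congr (_ - _ * _); apply: eq_bigr => n _.
    by rewrite numerical_flux_periodic trace_minus_periodic.
  by rewrite !trace_minus_periodic.
under eq_bigr do rewrite fg.
rewrite sumrB.
have -> : \sum_(j < Nx) f j.+1 = \sum_(j < Nx) f j.
  apply/eqP; rewrite -subr_eq0 -sumrB -(big_mkord xpredT (fun j => f j.+1 - f j)).
  by rewrite telescope_sumr// fP subrr.
rewrite -sumrB; apply: eq_bigr => j _.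
have C0 i n : (NH <= n)%N -> tm t i n = 0 /\ tp t i n = 0.
  move=> nN; have -> : C n t = cst 0 by apply/funext => y; rewrite (dg_ge_NH sol_C).
  by rewrite /trace_minus /trace_plus; split; apply: cvg_lim => //; exact: cvg_cst.
have := @numerical_flux_dissipation _ NH (alpha t)
  (fun n => delta NH alpha n t) (tm t j) (tp t j)
  (fun n nN => (C0 j n nN).1) (fun n nN => (C0 j n nN).2).
move=> <-; rewrite /f /g /nf.
transitivity (\sum_(n < NH) (nf n j * tm t j n - nf n j * tp t j n)
   - flux_potential NH (alpha t) (tm t j) + flux_potential NH (alpha t) (tp t j)).
  by rewrite sumrB; ring.
congr (_ - _ + _); apply: eq_bigr => n _.
by rewrite -mulrBr /nf numerical_fluxE// ltnW.
Qed.

Definition dg_energy t : R :=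
  alpha t * \sum_(j < Nx) \sum_(n < NH) Lam j (P n j t * P n j t).

Lemma dg_energy_ge0 t : 0 <= dg_energy t.
Proof.
apply: mulr_ge0; first exact: ltW.
apply: sumr_ge0 => j _; apply: sumr_ge0 => n _.
by apply: Rintegral_ge0 => y _; rewrite hornerM -expr2 sqr_ge0.
Qed.

Lemma wnorm_sq_energy t : 0 <= t ->
  wnorm_sq L alpha t (hermite_sum NH alpha C t) = (dg_energy t)%:E.
Proof.
move=> t0.
transitivity (\int[mu]_(y in `[0%R, L]) (alpha t * \sum_(n < NH) C n t y ^+ 2)%:E)%E.
  apply: eq_integral => y _.
  exact: (hermite_parseval NH (fun n => C n t y) (alpha_gt0 t)).
pose q j := alpha t *: \sum_(n < NH) P n j t * P n j t.
have fq j : (j < Nx)%N ->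
    {in `]x j, x j.+1[,
      (fun y => alpha t * \sum_(n < NH) C n t y ^+ 2) =1 horner (q j)}.
  move=> jN y yI; rewrite hornerZ horner_sum; congr (_ * _).
  by apply: eq_bigr => n _; rewrite hornerM (PC n jN t0)// expr2.
case: mesh_x => x0 xN _; have := mesh_integral x_lt fq; rewrite x0 xN => -[iq].
rewrite /Rintegral => h.
have := @integrable_fin_num _ _ _ mu _ (measurable_itv _) _ iq.
move=> /fineK <-; congr EFin; rewrite /= h /dg_energy mulr_sumr.
by apply: eq_bigr => j _; rewrite poly_integralZ poly_integral_sum.
Qed.

Lemma dg_energy_tderive t : 0 <= t -> is_tderive dg_energy t
  (time_derive alpha t * (\sum_(j < Nx) \sum_(n < NH) Lam j (P n j t * P n j t))
   + alpha t * \sum_(j < Nx) \sum_(n < NH) 2 * cell_balance n j t (C n t) (P n j t)).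
Proof.
move=> t0; have dalpha := is_tderive_scaling L_gt0 alpha0_gt0 gamma_gt0 field_E t0.
apply: is_tderiveM; first by rewrite (is_tderive_lim t0 dalpha).
apply: is_tderive_sum => j _; apply: is_tderive_sum => n _.
exact: cell_energy_tderive.
Qed.

(** [stretch_drive_le] holds at every point of the cell, with the local field as [e] and its sup
    norm, the one in [alpha'], as [M]; it is then integrated. *)
Lemma cell_stretch_drive_le j t : (j < Nx)%N -> 0 <= t ->
  \sum_(n < NH) (time_derive alpha t * Lam j (P n j t * P n j t)
    + 2 * (time_derive alpha t *
        Lam j ((n%:R *: P n j t + Num.sqrt (n.-1 * n)%:R *: P n.-2 j t) * P n j t))
    + 2 * (alpha t ^+ 2 * (rt n * Xi t j (P n.-1 j t * P n j t))))
  <= (2 * gamma)^-1 * (alpha t * \sum_(n < NH) Lam j (P n j t * P n j t)).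
Proof.
move=> jN t0; have [mE bE] := field_cell jN t0.
have dalpha := is_tderive_lim t0
  (is_tderive_scaling L_gt0 alpha0_gt0 gamma_gt0 field_E t0).
pose p n := time_derive alpha t *: (P n j t * P n j t + 2 *:
  ((n%:R *: P n j t + Num.sqrt (n.-1 * n)%:R *: P n.-2 j t) * P n j t)).
pose q n := (2 * alpha t ^+ 2 * rt n) *: (P n.-1 j t * P n j t).
pose r n := (alpha t / (2 * gamma)) *: (P n j t * P n j t).
have -> : (2 * gamma)^-1 * (alpha t * \sum_(n < NH) Lam j (P n j t * P n j t))
    = Lam j (\sum_(n < NH) r n).
  rewrite poly_integral_sum mulrA mulr_sumr; apply: eq_bigr => n _.
  by rewrite poly_integralZ [_^-1 * _]mulrC.
have := @poly_integral_weighted_le _ (E t) (x j) (x j.+1) _ (\sum_(n < NH) p n)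
  (\sum_(n < NH) q n) (\sum_(n < NH) r n) mE bE.
move=> h; apply: le_trans (h _).
  rewrite poly_integral_sum (weighted_integral_sum mE bE) -big_split/=.
  rewrite le_eqVlt; apply/orP; left; apply/eqP; apply: eq_bigr => n _.
  rewrite (weighted_integralZ mE bE) !(poly_integralZ, poly_integralD); ring.
move=> y yI; rewrite !horner_sum mulr_sumr -big_split/=.
have c0 n : (NH <= n)%N -> (P n j t).[y] = 0 by move=> nN; rewrite P_ge// horner0.
have := stretch_drive_le c0 (alpha_gt0 t) gamma_gt0 (bE y yI).
rewrite -dalpha => hle; apply: le_trans (le_trans hle _);
  rewrite le_eqVlt; apply/orP; left; apply/eqP; apply: eq_bigr => n _.
  by rewrite /p /q !(hornerZ, hornerM, hornerD); ring.
by rewrite /r !(hornerZ, hornerM) expr2.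
Qed.

Lemma dg_energy_dissipation t : 0 <= t ->
  time_derivable dg_energy t /\
  time_derive dg_energy t
    + alpha t * (\sum_(1 <= n < NH) \sum_(j < Nx)
        delta NH alpha n t * jump Nx x (C n t) j ^+ 2)
  <= (2 * gamma)^-1 * dg_energy t.
Proof.
move=> t0; have dE := dg_energy_tderive t0; split; first exact: is_tderive_derivable dE.
rewrite (is_tderive_lim t0 dE).
(* The [2] from differentiating a square cancels the [1 / 2] of the interface terms, and [delta]
   vanishes at index [0], so the sum may start at [1]. *)
have -> : \sum_(1 <= n < NH) \sum_(j < Nx) delta NH alpha n t * jump Nx x (C n t) j ^+ 2
    = 2 * \sum_(j < Nx) \sum_(n < NH) dg_form NH Nx x alpha C n t j (C n t).
  rewrite sum_dg_form// [in RHS]exchange_big/= mulr_sumr.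
  transitivity (\sum_(0 <= n < NH) \sum_(j < Nx)
      delta NH alpha n t * jump Nx x (C n t) j ^+ 2).
    have [->|NH0] := posnP NH; first by rewrite !big_geq//.
    rewrite [RHS]big_ltn// [X in X + _]big1 ?add0r// => j _.
    by rewrite /delta eqxx mul0r.
  rewrite big_mkord; apply: eq_bigr => n _; rewrite mulr_sumr; apply: eq_bigr => j _.
  by rewrite [RHS]mulrA divff ?mul1r// pnatr_eq0.
have : \sum_(j < Nx) \sum_(n < NH) (time_derive alpha t * Lam j (P n j t * P n j t)
    + 2 * (time_derive alpha t *
        Lam j ((n%:R *: P n j t + Num.sqrt (n.-1 * n)%:R *: P n.-2 j t) * P n j t))
    + 2 * (alpha t ^+ 2 * (rt n * Xi t j (P n.-1 j t * P n j t))))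
    <= (2 * gamma)^-1 * dg_energy t.
  rewrite /dg_energy mulrA mulr_sumr; apply: ler_sum => j _; rewrite -mulrA.
  exact: cell_stretch_drive_le.
apply: le_trans; rewrite le_eqVlt; apply/orP; left; apply/eqP.
rewrite !mulr_sumr -!big_split; apply: eq_bigr => j _ /=.
rewrite !mulr_sumr -!big_split; apply: eq_bigr => n _ /=.
by rewrite /cell_balance; field; rewrite gt_eqF.
Qed.

Lemma wnorm_energy t : 0 <= t ->
  wnorm L alpha t (hermite_sum NH alpha C t) = (Num.sqrt (dg_energy t))%:E.
Proof. by move=> t0; rewrite /wnorm wnorm_sq_energy. Qed.

Lemma wnorm_growth t : 0 <= t ->
  (wnorm L alpha t (hermite_sum NH alpha C t)
   <= wnorm L alpha 0%R (hermite_sum NH alpha C 0%R) * (expR (t / (4 * gamma)))%:E)%E.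
Proof.
move=> t0; rewrite !wnorm_energy// -EFinM lee_fin.
have g : dg_energy t <= dg_energy 0 * expR ((2 * gamma)^-1 * t).
  apply: (tgronwall (f' := time_derive dg_energy)) => // s s0.
    exact: (dg_energy_dissipation s0).1.
  apply: le_trans (dg_energy_dissipation s0).2; rewrite lerDl.
  apply: mulr_ge0; first exact: ltW.
  apply: sumr_ge0 => n _; apply: sumr_ge0 => j _; rewrite mulr_ge0 ?sqr_ge0//.
  by rewrite /delta; case: ifP => // _; rewrite divr_ge0 ?sqrtr_ge0 ?ltW.
apply: le_trans (ler_wsqrtr g) _; rewrite sqrtrM ?dg_energy_ge0//.
(* The exponential becomes a perfect square, so the root halves the growth rate. *)
have -> : (2 * gamma)^-1 * t = t / (4 * gamma) + t / (4 * gamma).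
  by field; rewrite gt_eqF.
by rewrite expRD -expr2 sqrtr_sqr ger0_norm ?expR_ge0.
Qed.

End Energy.

Theorem proposition3p2 (R : realType) (L alpha0 gamma : R)
  (Nx : nat) (x : nat -> R) (NH k : nat)
  (E : R -> R -> R) (C : nat -> R -> R -> R)
  (L_gt0 : 0 < L) (alpha0_gt0 : 0 < alpha0) (gamma_gt0 : 0 < gamma)
  (mesh_x : mesh L Nx x) (NH_ge1 : (1 <= NH)%N)
  (field_E : admissible_field L E)
  (sol_C : dg_solution NH Nx x (scaling L alpha0 gamma E) k E C) :
  let alpha := scaling L alpha0 gamma E in
  let f := hermite_sum NH alpha C in
  let norm_sq (t : R) := fine (wnorm_sq L alpha t (f t)) in
  (forall t : R, 0 <= t ->
     let mass (s : R) := \int[@lebesgue_measure R]_(y in `[0, L]) C 0%N s y in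
     time_derivable mass t /\ time_derive mass t = 0) /\
  ((wnorm L alpha 0%R (f 0%R) < +oo)%E ->
   (forall t : R, 0 <= t ->
      time_derivable norm_sq t /\
      time_derive norm_sq t
      + alpha t * (\sum_(1 <= n < NH) \sum_(j < Nx)
          delta NH alpha n t * jump Nx x (C n t) j ^+ 2)
      <= (2 * gamma)^-1 * norm_sq t) /\
   (forall t : R, 0 <= t ->
      (wnorm L alpha t (f t)
       <= wnorm L alpha 0%R (f 0%R) * (expR (t / (4 * gamma)))%:E)%E)).
Proof.
move=> alpha f norm_sq.
have [P [P_ge P_cell]] := cell_polynomials sol_C.
split=> [t t0 mass|_].
  have dm := mass_tderive mesh_x field_E sol_C P_cell t0 NH_ge1.
  by split; [exact: is_tderive_derivable dm|exact: is_tderive_lim dm].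
split=> t t0; last first.
  exact: (wnorm_growth L_gt0 alpha0_gt0 gamma_gt0 mesh_x field_E sol_C P_ge P_cell).
pose en := dg_energy L alpha0 gamma Nx x NH E P.
(* Agreement on the half-line suffices, since [time_quotient] samples no negative time. *)
have nE s : 0 <= s -> norm_sq s = en s.
  move=> s0; rewrite /norm_sq.
  by rewrite (wnorm_sq_energy NH E alpha0_gt0 gamma_gt0 mesh_x P_cell).
have [dE le] := dg_energy_dissipation L_gt0 alpha0_gt0 gamma_gt0 mesh_x
  field_E sol_C P_ge P_cell t0.
have dn : is_tderive norm_sq t (time_derive en t).
  by apply: eq_is_tderive t0 _ dE => s s0; rewrite nE.
split; first exact: is_tderive_derivable dn.
by rewrite (is_tderive_lim t0 dn) nE.
Qed.
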